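(* Let $G$ be a finite group and let $P$ be a collection of primes. Let $L \leq G$ be a $P$-perfect subgroup and let $e_L \in A(G)_{(P)}$ be the corresponding primitive idempotent. Fix subgroups $K \leq H \leq G$. Then the norm map $N_K^H \colon A(K)_{(P)} \to A(H)_{(P)}$ descends to a well-defined map of multiplicative monoids \[ \tilde{N}_K^H \colon A(K)_{(P)}[e_L^{-1}] \to A(H)_{(P)}[e_L^{-1}] \] if and only if the following holds: ($\star$) whenever $L' \leq H$ is conjugate in $G$ to $L$, then $L'$ is contained in $K$.
   Context: $\mathbb{Z}_{(P)}=\mathbb{Z}[p^{-1}\mid p\notin P]$. For $H\leq G$, $A(H)$ is the Burnside ring of finite $H$-sets and $A(H)_{(P)}=A(H)\otimes\mathbb{Z}_{(P)}$. $R^G_H$ denotes restriction. For $K\le H$ the norm $N_K^H\colon A(K)\to A(H)$ is the multiplicative map given on finite $K$-sets by co-induction $X\mapsto\mathrm{Map}_K(H,X)$, extended to virtual sets in the standard way (it is the norm of the Tambara functor $A(-)$); since inverting integers in $A(-)$ yields a Tambara functor, it extends to $N_K^H\colon A(K)_{(P)}\to A(H)_{(P)}$. For $Q\leq H$ the mark $\phi^Q\colon A(H)_{(P)}\to\mathbb{Z}_{(P)}$ is the ring homomorphism with $\phi^Q([S])=|S^Q|$; the marks are jointly injective. For a finite group $Q$, $O^P(Q)$ is the unique minimal normal subgroup of $Q$ such that $Q/O^P(Q)$ is a solvable group whose order is divisible only by primes in $P$; $Q$ is $P$-perfect if $Q=O^P(Q)$. By Dress, conjugacy classes of $P$-perfect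 subgroups $L\le G$ correspond bijectively to primitive idempotents $e_L\in A(G)_{(P)}$, where $\phi^Q(e_L)=1$ if $O^P(Q)$ is conjugate in $G$ to $L$, and $\phi^Q(e_L)=0$ otherwise. $A(H)_{(P)}[e_L^{-1}]$ is the localization of $A(H)_{(P)}$ at $R^G_H(e_L)$. ''$N_K^H$ descends to $\tilde N_K^H$'' means that there is a map of multiplicative monoids $\tilde N_K^H$ whose precomposition with the localization map $A(K)_{(P)}\to A(K)_{(P)}[e_L^{-1}]$ equals $N_K^H$ followed by the localization map $A(H)_{(P)}\to A(H)_{(P)}[e_L^{-1}]$. *)

(* Defs.v *)
From HB Require Import structures.
From mathcomp Require Import all_boot all_order all_algebra all_fingroup.
From mathcomp Require Import all_solvable generic_quotient.
From mathcomp Require Import boolp.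
From mathcomp Require Import ring.

Set Implicit Arguments.
Unset Strict Implicit.
Unset Printing Implicit Defensive.

Import GroupScope GRing.Theory.
Local Open Scope ring_scope.

Section Grothendieck.
Variable M : comPzSemiRingType.
Implicit Types x y z : M * M.

Definition groth_rel : rel (M * M) :=
  fun x y => `[< exists w, x.1 + y.2 + w = y.1 + x.2 + w >].

Fact groth_refl : reflexive groth_rel.
Proof. by move=> x; apply/asboolP; exists 0. Qed.

Fact groth_sym : symmetric groth_rel.
Proof. by move=> x y; apply/asboolP/asboolP => -[w e]; exists w. Qed.

Fact groth_trans : transitive groth_rel.
Proof.
move=> y x z /asboolP[v exy] /asboolP[w eyz]; apply/asboolP.
exists (y.1 + y.2 + v + w).
transitivity ((x.1 + y.2 + v) + (y.1 + z.2 + w)).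
  by ring.
by rewrite exy eyz; ring.
Qed.

Canonical groth_equiv := EquivRel groth_rel groth_refl groth_sym groth_trans.

Definition groth := {eq_quot groth_rel}%qT.

HB.instance Definition _ : EqQuotient _ groth_rel groth := EqQuotient.on groth.
HB.instance Definition _ := Choice.on groth.

Lemma grothP x y :
  (\pi_groth x = \pi_groth y)%qT <-> exists w, x.1 + y.2 + w = y.1 + x.2 + w.
Proof. by split=> [/eqmodP/asboolP | e]; last exact/eqmodP/asboolP. Qed.

Lemma groth_repr x :
  exists w, (repr (\pi_groth x)%qT).1 + x.2 + w
          = x.1 + (repr (\pi_groth x)%qT).2 + w.
Proof. by apply/grothP; rewrite reprK. Qed.

Definition groth_add :=
  lift_op2 groth (fun x y => (x.1 + y.1, x.2 + y.2)).
Definition groth_opp := lift_op1 groth (fun x => (x.2, x.1)).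
Definition groth_mul :=
  lift_op2 groth (fun x y => (x.1 * y.1 + x.2 * y.2, x.1 * y.2 + x.2 * y.1)).

Lemma pi_groth_add x y :
  groth_add (\pi_groth x)%qT (\pi_groth y)%qT
  = \pi_groth%qT (x.1 + y.1, x.2 + y.2).
Proof.
have [[v ev] [w ew]] := (groth_repr x, groth_repr y).
unlock groth_add; move: (repr _) (repr _) ev ew => b a ev ew.
apply/grothP => /=; exists (v + w).
transitivity ((a.1 + x.2 + v) + (b.1 + y.2 + w)).
  by ring.
by rewrite ev ew; ring.
Qed.

Lemma pi_groth_opp x : groth_opp (\pi_groth x)%qT = \pi_groth%qT (x.2, x.1).
Proof.
have [v ev] := groth_repr x; unlock groth_opp; apply/grothP; exists v => /=.
by rewrite [_ + x.1]addrC -ev; ring.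
Qed.

Lemma pi_groth_mul x y :
  groth_mul (\pi_groth x)%qT (\pi_groth y)%qT
  = \pi_groth%qT (x.1 * y.1 + x.2 * y.2, x.1 * y.2 + x.2 * y.1).
Proof.
unlock groth_mul; transitivity (\pi_groth%qT
  ((repr (\pi_groth x)%qT).1 * y.1 + (repr (\pi_groth x)%qT).2 * y.2,
   (repr (\pi_groth x)%qT).1 * y.2 + (repr (\pi_groth x)%qT).2 * y.1)).
  have [w ew] := groth_repr y; move: (repr _) (repr _) ew => a b ew.
  apply/grothP; exists (a.1 * w + a.2 * w) => /=.
  transitivity (a.1 * (b.1 + y.2 + w) + a.2 * (y.1 + b.2 + w)); last first.
    by rewrite {1}ew -{2}ew; ring.
  by ring.
have [w ew] := groth_repr x; move: (repr _) ew => a ew.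
apply/grothP; exists (w * y.1 + w * y.2) => /=.
transitivity ((a.1 + x.2 + w) * y.1 + (x.1 + a.2 + w) * y.2).
  by ring.
by rewrite {1}ew -{2}ew; ring.
Qed.

Let quotE := (pi_groth_add, pi_groth_opp, pi_groth_mul).

Fact groth_addA : associative groth_add.
Proof.
by elim/quotW=> x; elim/quotW=> y; elim/quotW=> z; rewrite !quotE /= !addrA.
Qed.

Fact groth_addC : commutative groth_add.
Proof.
by elim/quotW=> x; elim/quotW=> y; rewrite !quotE /= addrC [x.2 + _]addrC.
Qed.

Fact groth_add0 : left_id (\pi_groth%qT (0, 0)) groth_add.
Proof. by elim/quotW=> -[a b]; rewrite !quotE /= !add0r. Qed.

Fact groth_addN : left_inverse (\pi_groth%qT (0, 0)) groth_opp groth_add.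
Proof.
by elim/quotW=> x; rewrite !quotE; apply/grothP; exists 0; rewrite /=; ring.
Qed.

HB.instance Definition _ :=
  GRing.isZmodule.Build groth groth_addA groth_addC groth_add0 groth_addN.

Fact groth_mulA : associative groth_mul.
Proof.
elim/quotW=> x; elim/quotW=> y; elim/quotW=> z; rewrite !quotE /=.
by congr (\pi_groth (_, _))%qT; ring.
Qed.

Fact groth_mulC : commutative groth_mul.
Proof.
elim/quotW=> x; elim/quotW=> y; rewrite !quotE /=.
by congr (\pi_groth (_, _))%qT; ring.
Qed.

Fact groth_mul1 : left_id (\pi_groth%qT (1, 0)) groth_mul.
Proof.
by elim/quotW=> -[a b]; rewrite !quotE /= !mul1r !mul0r !addr0.
Qed.

Fact groth_mulDl : left_distributive groth_mul groth_add.
Proof.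
elim/quotW=> x; elim/quotW=> y; elim/quotW=> z; rewrite !quotE /=.
by congr (\pi_groth (_, _))%qT; ring.
Qed.

HB.instance Definition _ := GRing.Zmodule_isComPzRing.Build groth
  groth_mulA groth_mulC groth_mul1 groth_mulDl.

Definition to_groth (a : M) : groth := \pi_groth%qT (a, 0).

Fact to_groth_is_nmod_morphism : nmod_morphism to_groth.
Proof.
by split=> // a b; rewrite [RHS]pi_groth_add /to_groth /= addr0.
Qed.

Fact to_groth_is_monoid_morphism : monoid_morphism to_groth.
Proof.
split=> // a b; rewrite [RHS]pi_groth_mul /to_groth /=.
by rewrite !mulr0 mul0r !addr0.
Qed.

HB.instance Definition _ :=
  GRing.isNmodMorphism.Build M groth to_groth to_groth_is_nmod_morphism.
HB.instance Definition _ :=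
  GRing.isMonoidMorphism.Build M groth to_groth to_groth_is_monoid_morphism.

Lemma pi_grothE x : \pi_groth%qT x = to_groth x.1 - to_groth x.2.
Proof.
rewrite [- _]pi_groth_opp [RHS]pi_groth_add /= addr0 add0r.
by case: x.
Qed.

Lemma grothE (u : groth) : u = to_groth (repr u).1 - to_groth (repr u).2.
Proof. by rewrite -pi_grothE reprK. Qed.

Section Extension.
Variable A : comPzRingType.

Definition groth_ext (f : M -> A) (u : groth) : A := f (repr u).1 - f (repr u).2.

(* For f polynomial of degree at most d, [n |-> f (x + n *: y)] is a
   polynomial of degree at most d in n, and the sum below is the value at
   n = -1 of the polynomial interpolating it at n = 0, ..., d; hence this is
   the value at x - y of the unique polynomial extension of f to virtual
   elements, independently of the chosen representative. *)
Definition groth_poly_ext (d : nat) (f : M -> A) (u : groth) : A :=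
  \sum_(j < d.+1)
    (-1) ^+ j * f ((repr u).1 + (repr u).2 *+ j) *+ 'C(d.+1, j.+1).

Variable f : {rmorphism M -> A}.

Lemma groth_ext_pi x : groth_ext f (\pi_groth%qT x) = f x.1 - f x.2.
Proof.
have [w] := groth_repr x; rewrite /groth_ext.
move: (repr _) => a /(congr1 f); rewrite !rmorphD => /addIr e.
by apply/eqP; rewrite subr_eq addrAC eq_sym subr_eq e.
Qed.

Lemma groth_extE a : groth_ext f (to_groth a) = f a.
Proof. by rewrite groth_ext_pi rmorph0 subr0. Qed.

Fact groth_ext_is_nmod_morphism : nmod_morphism (groth_ext f).
Proof.
split=> [|u v]; first by rewrite groth_ext_pi subrr.
elim/quotW: u => x; elim/quotW: v => y.
by rewrite [_ + _]pi_groth_add !groth_ext_pi /= !rmorphD; ring.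
Qed.

Fact groth_ext_is_monoid_morphism : monoid_morphism (groth_ext f).
Proof.
split=> [|u v]; first by rewrite groth_ext_pi rmorph0 rmorph1 subr0.
elim/quotW: u => x; elim/quotW: v => y.
by rewrite [_ * _]pi_groth_mul !groth_ext_pi /= !rmorphD !rmorphM; ring.
Qed.

HB.instance Definition _ := GRing.isNmodMorphism.Build groth A
  (groth_ext f) groth_ext_is_nmod_morphism.
HB.instance Definition _ := GRing.isMonoidMorphism.Build groth A
  (groth_ext f) groth_ext_is_monoid_morphism.

End Extension.

End Grothendieck.

Arguments groth_ext {M A} f u.
Arguments groth_poly_ext {M A} d f u.

Section Localization.
Variables (R : comPzRingType) (S : mulrClosed R).

Definition denom := {s : R | s \in S}.
HB.instance Definition _ := Choice.on denom.

Definition denom1 : denom := exist _ 1 (rpred1 S).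
Definition denomM (s t : denom) : denom :=
  exist _ (sval s * sval t) (rpredM (svalP s) (svalP t)).

Definition loc_rel : rel (R * denom) :=
  fun x y => `[< exists2 u, u \in S &
                  u * (x.1 * sval y.2) = u * (y.1 * sval x.2) >].

Fact loc_refl : reflexive loc_rel.
Proof. by move=> x; apply/asboolP; exists 1; rewrite ?rpred1. Qed.

Fact loc_sym : symmetric loc_rel.
Proof. by move=> x y; apply/asboolP/asboolP => -[u Su e]; exists u. Qed.

Fact loc_trans : transitive loc_rel.
Proof.
move=> y x z /asboolP[u Su exy] /asboolP[v Sv eyz]; apply/asboolP.
exists (u * v * sval y.2); first by rewrite !rpredM ?(svalP y.2).
transitivity (u * (x.1 * sval y.2) * (v * sval z.2)); first by ring.
rewrite exy; transitivity (v * (y.1 * sval z.2) * (u * sval x.2)); first by ring.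
by rewrite eyz; ring.
Qed.

Canonical loc_equiv := EquivRel loc_rel loc_refl loc_sym loc_trans.

Definition loc := {eq_quot loc_rel}%qT.

HB.instance Definition _ : EqQuotient _ loc_rel loc := EqQuotient.on loc.
HB.instance Definition _ := Choice.on loc.

Implicit Types x y z : R * denom.

Lemma locP x y : (\pi_loc x = \pi_loc y)%qT <->
  exists2 u, u \in S & u * (x.1 * sval y.2) = u * (y.1 * sval x.2).
Proof. by split=> [/eqmodP/asboolP | e]; last exact/eqmodP/asboolP. Qed.

Lemma loc_repr x : exists2 u, u \in S &
  u * ((repr (\pi_loc x)%qT).1 * sval x.2)
  = u * (x.1 * sval (repr (\pi_loc x)%qT).2).
Proof. by apply/locP; rewrite reprK. Qed.

Definition loc_add := lift_op2 loc (fun x y =>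
  (x.1 * sval y.2 + y.1 * sval x.2, denomM x.2 y.2)).
Definition loc_opp := lift_op1 loc (fun x => (- x.1, x.2)).
Definition loc_mul := lift_op2 loc (fun x y => (x.1 * y.1, denomM x.2 y.2)).

Lemma pi_loc_add x y :
  loc_add (\pi_loc x)%qT (\pi_loc y)%qT
  = \pi_loc%qT (x.1 * sval y.2 + y.1 * sval x.2, denomM x.2 y.2).
Proof.
have [[u Su eu] [v Sv ev]] := (loc_repr x, loc_repr y).
unlock loc_add; move: (repr _) (repr _) eu ev => b a eu ev.
apply/locP; exists (u * v); rewrite ?rpredM //=.
transitivity ((u * (a.1 * sval x.2)) * (v * sval b.2 * sval y.2)
            + (v * (b.1 * sval y.2)) * (u * sval a.2 * sval x.2)); first by ring.
by rewrite eu ev; ring.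
Qed.

Lemma pi_loc_opp x : loc_opp (\pi_loc x)%qT = \pi_loc%qT (- x.1, x.2).
Proof.
have [u Su eu] := loc_repr x; unlock loc_opp; apply/locP; exists u => //=.
by rewrite !mulNr !mulrN eu.
Qed.

Lemma pi_loc_mul x y :
  loc_mul (\pi_loc x)%qT (\pi_loc y)%qT
  = \pi_loc%qT (x.1 * y.1, denomM x.2 y.2).
Proof.
have [[u Su eu] [v Sv ev]] := (loc_repr x, loc_repr y).
unlock loc_mul; move: (repr _) (repr _) eu ev => b a eu ev.
apply/locP; exists (u * v); rewrite ?rpredM //=.
transitivity ((u * (a.1 * sval x.2)) * (v * (b.1 * sval y.2))); first by ring.
by rewrite eu ev; ring.
Qed.

Let quotE := (pi_loc_add, pi_loc_opp, pi_loc_mul).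

Ltac loc_ring :=
  rewrite ?quotE; apply/locP; exists 1; [exact: rpred1 | rewrite /=; ring].

Fact loc_addA : associative loc_add.
Proof. by elim/quotW=> x; elim/quotW=> y; elim/quotW=> z; loc_ring. Qed.

Fact loc_addC : commutative loc_add.
Proof. by elim/quotW=> x; elim/quotW=> y; loc_ring. Qed.

Fact loc_add0 : left_id (\pi_loc%qT (0, denom1)) loc_add.
Proof. by elim/quotW=> x; loc_ring. Qed.

Fact loc_addN : left_inverse (\pi_loc%qT (0, denom1)) loc_opp loc_add.
Proof. by elim/quotW=> x; loc_ring. Qed.

HB.instance Definition _ :=
  GRing.isZmodule.Build loc loc_addA loc_addC loc_add0 loc_addN.

Fact loc_mulA : associative loc_mul.
Proof. by elim/quotW=> x; elim/quotW=> y; elim/quotW=> z; loc_ring. Qed.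

Fact loc_mulC : commutative loc_mul.
Proof. by elim/quotW=> x; elim/quotW=> y; loc_ring. Qed.

Fact loc_mul1 : left_id (\pi_loc%qT (1, denom1)) loc_mul.
Proof. by elim/quotW=> x; loc_ring. Qed.

Fact loc_mulDl : left_distributive loc_mul loc_add.
Proof. by elim/quotW=> x; elim/quotW=> y; elim/quotW=> z; loc_ring. Qed.

HB.instance Definition _ := GRing.Zmodule_isComPzRing.Build loc
  loc_mulA loc_mulC loc_mul1 loc_mulDl.

Definition to_loc (a : R) : loc := \pi_loc%qT (a, denom1).

Fact to_loc_is_nmod_morphism : nmod_morphism to_loc.
Proof. by split=> // a b; rewrite [RHS]pi_loc_add; loc_ring. Qed.

Fact to_loc_is_monoid_morphism : monoid_morphism to_loc.
Proof. by split=> // a b; rewrite [RHS]pi_loc_mul; loc_ring. Qed.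

HB.instance Definition _ :=
  GRing.isNmodMorphism.Build R loc to_loc to_loc_is_nmod_morphism.
HB.instance Definition _ :=
  GRing.isMonoidMorphism.Build R loc to_loc to_loc_is_monoid_morphism.

End Localization.

Definition invertible (R : comPzRingType) (x : R) := exists y, x * y = 1.

(* The inverse of x if x is invertible, and x otherwise. *)
Definition pinv (R : comPzRingType) (x : R) : R :=
  if pselect (invertible x) is left h then sval (cid h) else x.

Lemma mulr_pinv (R : comPzRingType) (x : R) : invertible x -> x * pinv x = 1.
Proof. by rewrite /pinv; case: pselect => // h _; case: cid. Qed.

Lemma pinv_unique (R : comPzRingType) (x y : R) : x * y = 1 -> pinv x = y.
Proof.
move=> e; have/mulr_pinv e': invertible x by exists y.
by rewrite -[RHS]mul1r -e' mulrAC e mul1r.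
Qed.

Section LocExtension.
Variables (R : comPzRingType) (S : mulrClosed R) (R' : comPzRingType).

(* The extension of a multiplicative map f that sends S to units: it maps
   a / s to f a / f s. *)
Definition loc_ext (f : R -> R') (u : loc S) : R' :=
  f (repr u).1 * pinv (f (sval (repr u).2)).

Lemma loc_ext_pi (f : R -> R') (x : R * denom S) :
    monoid_morphism f -> (forall s, s \in S -> invertible (f s)) ->
  loc_ext f (\pi_(loc S)%qT x) = f x.1 * pinv (f (sval x.2)).
Proof.
move=> [f1 fM] fS; have [u Su] := loc_repr x; rewrite /loc_ext.
move: (repr _) => a /(congr1 f); rewrite !fM => eu.
have {eu}eu : f a.1 * f (sval x.2) = f x.1 * f (sval a.2).
  have ku := mulr_pinv (fS _ Su).
  by rewrite -[LHS]mul1r -[RHS]mul1r -ku mulrAC eu mulrAC.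
have ka := mulr_pinv (fS _ (svalP a.2)); have kx := mulr_pinv (fS _ (svalP x.2)).
rewrite -[LHS]mulr1 -[RHS]mulr1 -{1}kx -ka.
transitivity (f a.1 * f (sval x.2) * (pinv (f (sval a.2)) * pinv (f (sval x.2)))).
  by ring.
by rewrite eu; ring.
Qed.

Lemma loc_extE (f : R -> R') a :
    monoid_morphism f -> (forall s, s \in S -> invertible (f s)) ->
  loc_ext f (to_loc S a) = f a.
Proof.
move=> fm fS; rewrite loc_ext_pi //= fm.1 (@pinv_unique _ 1 1) ?mulr1 //.
Qed.

End LocExtension.

Arguments loc_ext {R} S {R'} f u.

Section MulSets.
Variable R : comPzRingType.

Definition powers (e : R) : {pred R} := fun x => `[< exists n, x = e ^+ n >].

Fact powers_mulr_closed e : mulr_closed (powers e).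
Proof.
split; first by apply/asboolP; exists 0%N.
move=> x y /asboolP[m ->] /asboolP[n ->]; apply/asboolP; exists (m + n)%N.
by rewrite exprD.
Qed.

HB.instance Definition _ e :=
  GRing.isMulClosed.Build R (powers e) (powers_mulr_closed e).

Definition pnat_elts (P : nat_pred) : {pred R} :=
  fun x => `[< exists2 n, P^'.-nat n & x = n%:R >].

Fact pnat_elts_mulr_closed P : mulr_closed (pnat_elts P).
Proof.
split; first by apply/asboolP; exists 1%N.
move=> x y /asboolP[m Pm ->] /asboolP[n Pn ->]; apply/asboolP.
by exists (m * n)%N; rewrite ?natrM // pnatM Pm.
Qed.

HB.instance Definition _ P :=
  GRing.isMulClosed.Build R (pnat_elts P) (pnat_elts_mulr_closed P).

(* R tensored with Z_(P) = Z[1/p : p \notin P], i.e. R with all positive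
   integers prime to P inverted; plocal int P is Z_(P) itself. *)
Definition plocal (P : nat_pred) := loc (pnat_elts P).
HB.instance Definition _ P := GRing.ComPzRing.on (plocal P).
Definition to_plocal (P : nat_pred) : R -> plocal P := to_loc (pnat_elts P).
HB.instance Definition _ P := GRing.RMorphism.on (to_plocal P).

Definition away (e : R) := loc (powers e).
HB.instance Definition _ e := GRing.ComPzRing.on (away e).
Definition to_away (e : R) : R -> away e := to_loc (powers e).
HB.instance Definition _ e := GRing.RMorphism.on (to_away e).

End MulSets.

(* The extension to plocal of a multiplicative map f, provided it sends
   integers prime to P to units of plocal R' P. *)
Definition plocal_map (R R' : comPzRingType) (P : nat_pred) (f : R -> R') :
  plocal R P -> plocal R' P := loc_ext (pnat_elts P) (to_plocal P \o f).

Arguments plocal_map {R R'} P f u.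

(* A finite H-set is a finType T with an action of H on T. As everywhere in
   the action library, groups act on the right. *)

Section GSetConstructions.
Variables (gT : finGroupType) (H : {set gT}).

Definition act_iso (T1 T2 : Type) (to1 : action H T1) (to2 : action H T2) :=
  exists2 f : T1 -> T2, bijective f &
    {in H, forall a x, f (to1 x a) = to2 (f x) a}.

Lemma act_iso_refl T (to : action H T) : act_iso to to.
Proof. by exists id => //; exists id. Qed.

Lemma act_iso_sym T1 T2 (to1 : action H T1) (to2 : action H T2) :
  act_iso to1 to2 -> act_iso to2 to1.
Proof.
case=> f [g fK gK] fH; exists g => [|a Ha y]; first by exists f.
by rewrite -{1}(gK y) -fH // fK.
Qed.

Lemma act_iso_trans T2 T1 T3 (to1 : action H T1) (to2 : action H T2)
    (to3 : action H T3) :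
  act_iso to1 to2 -> act_iso to2 to3 -> act_iso to1 to3.
Proof.
move=> [f bf fH] [g bg gH]; exists (g \o f); first exact: bij_comp.
by move=> a Ha x /=; rewrite fH // gH.
Qed.

Section Sum.
Variables (T1 T2 : finType) (to1 : action H T1) (to2 : action H T2).

Definition sum_to (z : T1 + T2) a : T1 + T2 :=
  match z with inl x => inl (to1 x a) | inr y => inr (to2 y a) end.

Fact sum_is_action : is_action H sum_to.
Proof.
split=> [a|z a b Ha Hb]; last by case: z => x; rewrite /sum_to actMin.
by case=> x [] // y [e]; rewrite (act_inj _ _ e).
Qed.
Definition sum_act := Action sum_is_action.

Definition prod_to (z : T1 * T2) a : T1 * T2 := (to1 z.1 a, to2 z.2 a).

Fact prod_is_action : is_action H prod_to.
Proof.
split=> [a [x y] [x' y'] [] /= e1 e2|z a b Ha Hb].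
  by rewrite (act_inj _ _ e1) (act_inj _ _ e2).
by rewrite /prod_to !actMin.
Qed.
Definition prod_act := Action prod_is_action.

End Sum.

Fact triv_is_action (T : Type) : is_action H (fun (x : T) (_ : gT) => x).
Proof. by split=> [a x y|x a b]. Qed.
Definition triv_act T := Action (triv_is_action T).

Section Transport.
Variables (T : finType) (to : action H T).

Definition ord_to (i : 'I_#|T|) a := enum_rank (to (enum_val i) a).

Fact ord_is_action : is_action H ord_to.
Proof.
split=> [a i j /enum_rank_inj e|i a b Ha Hb].
  exact: enum_val_inj (act_inj _ _ e).
by rewrite /ord_to enum_rankK actMin.
Qed.
Definition ord_act := Action ord_is_action.

Lemma ord_act_iso : act_iso ord_act to.
Proof.
exists enum_val => [|a Ha i]; last by rewrite /= /ord_to enum_rankK.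
by exists enum_rank; [apply: enum_valK | apply: enum_rankK].
Qed.

End Transport.

End GSetConstructions.

Section Burnside.
Variables (gT : finGroupType) (H : {group gT}).

(* The finite H-sets do not form a small enough type to be quotiented (universe
   constraints), so isomorphism classes are taken among the actions on some
   'I_n, which represent all finite H-sets by ord_act_iso. *)
Definition ogset := {n : nat & action H 'I_n}.
HB.instance Definition _ := gen_eqMixin ogset.
HB.instance Definition _ := gen_choiceMixin ogset.

Implicit Types X Y Z : ogset.

Definition oact X : action H 'I_(tag X) := tagged X.
Definition ogset_of (T : finType) (to : action H T) : ogset :=
  Tagged (fun n => action H 'I_n) (ord_act to).

Definition ogset_rel : rel ogset := fun X Y => `[< act_iso (oact X) (oact Y) >].

Fact ogset_refl : reflexive ogset_rel.
Proof. by move=> X; apply/asboolP/act_iso_refl. Qed.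

Fact ogset_sym : symmetric ogset_rel.
Proof. by move=> X Y; apply/asboolP/asboolP => /act_iso_sym. Qed.

Fact ogset_trans : transitive ogset_rel.
Proof.
move=> Y X Z /asboolP XY /asboolP YZ.
exact/asboolP/(act_iso_trans XY YZ).
Qed.

Canonical ogset_equiv := EquivRel ogset_rel ogset_refl ogset_sym ogset_trans.

Definition gclass := {eq_quot ogset_rel}%qT.

HB.instance Definition _ : EqQuotient _ ogset_rel gclass :=
  EqQuotient.on gclass.
HB.instance Definition _ := Choice.on gclass.

Lemma gclassP X Y :
  (\pi_gclass X = \pi_gclass Y)%qT <-> act_iso (oact X) (oact Y).
Proof. by split=> [/eqmodP/asboolP | e]; last exact/eqmodP/asboolP. Qed.

Definition gclass_of (T : finType) (to : action H T) : gclass :=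
  \pi_gclass%qT (ogset_of to).

Definition gclass_act (u : gclass) : action H 'I_(tag (repr u)) :=
  oact (repr u).

Lemma gclass_ofP (T1 T2 : finType) (to1 : action H T1) (to2 : action H T2) :
  gclass_of to1 = gclass_of to2 <-> act_iso to1 to2.
Proof.
have [i1 i2] := (ord_act_iso to1, ord_act_iso to2).
split=> [/gclassP i | i].
  exact: act_iso_trans (act_iso_sym i1) (act_iso_trans i i2).
apply/gclassP.
exact: act_iso_trans (act_iso_trans i1 i) (act_iso_sym i2).
Qed.

Lemma gclass_act_iso (T : finType) (to : action H T) :
  act_iso (gclass_act (gclass_of to)) to.
Proof.
apply: act_iso_trans (ord_act_iso to).
by apply/(gclassP (repr (gclass_of to)) (ogset_of to)); rewrite reprK.
Qed.

Lemma gclass_actK (u : gclass) : gclass_of (gclass_act u) = u.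
Proof.
by rewrite -[RHS]reprK; apply/gclassP/ord_act_iso.
Qed.

Lemma gclass_ind (A : gclass -> Prop) :
  (forall (T : finType) (to : action H T), A (gclass_of to)) -> forall u, A u.
Proof. by move=> Aof u; rewrite -(gclass_actK u). Qed.

Definition gclass_add u v :=
  locked (gclass_of (sum_act (gclass_act u) (gclass_act v))).
Definition gclass_mul u v :=
  locked (gclass_of (prod_act (gclass_act u) (gclass_act v))).

Section Two.
Variables (T1 T2 : finType) (to1 : action H T1) (to2 : action H T2).

Lemma gclass_ofD :
  gclass_add (gclass_of to1) (gclass_of to2) = gclass_of (sum_act to1 to2).
Proof.
have [f [f' fK f'K] fH] := gclass_act_iso to1.
have [g [g' gK g'K] gH] := gclass_act_iso to2.
rewrite /gclass_add -lock; apply/gclass_ofP.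
exists (fun z => match z with inl x => inl (f x) | inr y => inr (g y) end).
  exists (fun z => match z with inl x => inl (f' x) | inr y => inr (g' y) end).
    by case=> x; rewrite ?fK ?gK.
  by case=> x; rewrite ?f'K ?g'K.
by move=> a Ha [x|y] /=; rewrite ?fH ?gH.
Qed.

Lemma gclass_ofM :
  gclass_mul (gclass_of to1) (gclass_of to2) = gclass_of (prod_act to1 to2).
Proof.
have [f [f' fK f'K] fH] := gclass_act_iso to1.
have [g [g' gK g'K] gH] := gclass_act_iso to2.
rewrite /gclass_mul -lock; apply/gclass_ofP; exists (fun z => (f z.1, g z.2)).
  exists (fun z => (f' z.1, g' z.2)) => -[x y] /=; first by rewrite fK gK.
  by rewrite f'K g'K.
by move=> a Ha [x y] /=; rewrite /prod_to fH ?gH.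
Qed.

End Two.

Let ofE := (gclass_ofD, gclass_ofM).

Fact gclass_addA : associative gclass_add.
Proof.
elim/gclass_ind=> T1 t1; elim/gclass_ind=> T2 t2; elim/gclass_ind=> T3 t3.
rewrite !ofE; apply/gclass_ofP.
exists (fun s : T1 + (T2 + T3) => match s with
  inl x => inl (inl x) | inr (inl y) => inl (inr y) | inr (inr z) => inr z end).
  exists (fun s : (T1 + T2) + T3 => match s with
    inl (inl x) => inl x | inl (inr y) => inr (inl y) | inr z => inr (inr z)
    end); by [case=> [|[]] | case=> [[]|]].
by move=> a Ha [|[]].
Qed.

Fact gclass_addC : commutative gclass_add.
Proof.
elim/gclass_ind=> T1 t1; elim/gclass_ind=> T2 t2; rewrite !ofE.
apply/gclass_ofP.
exists (fun s : T1 + T2 => match s with inl x => inr x | inr y => inl y end).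
  exists (fun s : T2 + T1 => match s with inl x => inr x | inr y => inl y end);
  by case.
by move=> a Ha [].
Qed.

Fact gclass_add0 : left_id (gclass_of (triv_act H void)) gclass_add.
Proof.
elim/gclass_ind=> T t; rewrite !ofE; apply/gclass_ofP.
exists (fun s : void + T => match s with inl v => of_void T v | inr x => x end).
  by exists inr; [case=> [[]|] |].
by move=> a Ha [[]|].
Qed.

HB.instance Definition _ :=
  GRing.isNmodule.Build gclass gclass_addA gclass_addC gclass_add0.

Fact gclass_mulA : associative gclass_mul.
Proof.
elim/gclass_ind=> T1 t1; elim/gclass_ind=> T2 t2; elim/gclass_ind=> T3 t3.
rewrite !ofE; apply/gclass_ofP.
exists (fun s : T1 * (T2 * T3) => ((s.1, s.2.1), s.2.2)) => //.
exists (fun s : (T1 * T2) * T3 => (s.1.1, (s.1.2, s.2))); first by case=> ? [].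
by case=> [[]].
Qed.

Fact gclass_mulC : commutative gclass_mul.
Proof.
elim/gclass_ind=> T1 t1; elim/gclass_ind=> T2 t2; rewrite !ofE.
apply/gclass_ofP; exists (fun s : T1 * T2 => (s.2, s.1)) => //.
by exists (fun s : T2 * T1 => (s.2, s.1)); case.
Qed.

Fact gclass_mul1 : left_id (gclass_of (triv_act H unit)) gclass_mul.
Proof.
elim/gclass_ind=> T t; rewrite !ofE; apply/gclass_ofP.
exists (fun s : unit * T => s.2) => //.
by exists (fun x => (tt, x)) => // -[[]].
Qed.

Fact gclass_mulDl : left_distributive gclass_mul gclass_add.
Proof.
elim/gclass_ind=> T1 t1; elim/gclass_ind=> T2 t2; elim/gclass_ind=> T3 t3.
rewrite !ofE; apply/gclass_ofP.
exists (fun s : (T1 + T2) * T3 => match s.1 with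
          inl x => inl (x, s.2) | inr y => inr (y, s.2) end).
  exists (fun s : T1 * T3 + T2 * T3 => match s with
            inl u => (inl u.1, u.2) | inr u => (inr u.1, u.2) end).
    by case=> [[]].
  by case=> [[]|[]].
by move=> a Ha [[]].
Qed.

Fact gclass_mul0 : left_zero (gclass_of (triv_act H void)) gclass_mul.
Proof.
elim/gclass_ind=> T t; rewrite !ofE; apply/gclass_ofP.
exists (fun s : void * T => s.1); last by move=> a Ha [].
by exists (fun v : void => of_void _ v); case.
Qed.

HB.instance Definition _ := GRing.Nmodule_isComPzSemiRing.Build gclass
  gclass_mulA gclass_mulC gclass_mul1 gclass_mulDl gclass_mul0.

Definition burnside := groth gclass.
HB.instance Definition _ := GRing.ComPzRing.on burnside.

Definition burnside_class (T : finType) (to : action H T) : burnside :=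
  to_groth (gclass_of to).

End Burnside.

Section Mark.
Variables (gT : finGroupType) (H : {group gT}) (Q : {set gT}).

Definition gclass_mark (u : gclass H) : int := #|'Fix_(gclass_act u)(Q)|%:Z.

(* This is the mark homomorphism when Q is a subgroup of H. *)
Definition mark : burnside H -> int := groth_ext gclass_mark.

Hypothesis sQH : Q \subset H.

Lemma card_afix_iso (T1 T2 : finType) (to1 : action H T1) (to2 : action H T2) :
  act_iso to1 to2 -> #|'Fix_to1(Q)| = #|'Fix_to2(Q)|.
Proof.
case=> f [g fK gK] fH.
rewrite -(card_imset _ (can_inj fK)); apply/eq_card => y.
apply/imsetP/afixP => [[x /afixP xQ ->] a Qa | yQ].
  by rewrite -fH ?(subsetP sQH) // xQ.
exists (g y); rewrite ?gK //; apply/afixP => a Qa.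
by apply: (can_inj fK); rewrite fH ?(subsetP sQH) // gK yQ.
Qed.

Lemma gclass_mark_of (T : finType) (to : action H T) :
  gclass_mark (gclass_of to) = #|'Fix_to(Q)|%:Z.
Proof. by congr (Posz _); apply/card_afix_iso/gclass_act_iso. Qed.

Fact gclass_mark_is_nmod_morphism : nmod_morphism gclass_mark.
Proof.
split=> [|u v].
  rewrite gclass_mark_of; congr (Posz _); apply/eqP.
  by rewrite cards_eq0; apply/eqP/setP; case.
elim/gclass_ind: u => T1 to1; elim/gclass_ind: v => T2 to2.
rewrite [_ + _]gclass_ofD !gclass_mark_of -PoszD; congr (Posz _).
rewrite -(card_imset _ (@inl_inj T1 T2)) -(card_imset _ (@inr_inj T1 T2)).
have dj : [set (inl x : T1 + T2) | x in 'Fix_to1(Q)]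
          :&: [set inr x | x in 'Fix_to2(Q)] = set0.
  by apply/setP => z; rewrite !inE; apply/andP => -[/imsetP[? _ ->] /imsetP[]].
rewrite -cardsUI dj cards0 addn0.
apply/eq_card => -[x|x]; rewrite in_setU.
  rewrite (mem_imset _ _ (@inl_inj T1 T2)) [_ \in inr @: _](_ : _ = false).
    rewrite orbF; apply/afixP/afixP => xQ a Qa; last by rewrite /= xQ.
    by have [] := xQ a Qa.
  by apply/imsetP => -[].
rewrite (mem_imset _ _ (@inr_inj T1 T2)) [_ \in inl @: _](_ : _ = false).
  apply/afixP/afixP => xQ a Qa; last by rewrite /= xQ.
  by have [] := xQ a Qa.
by apply/imsetP => -[].
Qed.

Fact gclass_mark_is_monoid_morphism : monoid_morphism gclass_mark.
Proof.
split=> [|u v].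
  rewrite gclass_mark_of; congr (Posz _).
  by rewrite -[RHS]card_unit -cardsT; apply/eq_card => x; rewrite in_setT;
    apply/afixP.
elim/gclass_ind: u => T1 to1; elim/gclass_ind: v => T2 to2.
rewrite [_ * _]gclass_ofM !gclass_mark_of -PoszM; congr (Posz _).
rewrite -cardsX; apply/eq_card => -[x y]; rewrite in_setX.
apply/afixP/andP => [xyQ | [/afixP xQ /afixP yQ] a Qa]; last first.
  by rewrite /= /prod_to xQ ?yQ.
by split; apply/afixP => a Qa; have [] := xyQ a Qa.
Qed.

Lemma mark_class (T : finType) (to : action H T) :
  mark (burnside_class to) = #|'Fix_to(Q)|%:Z.
Proof.
pose nm := GRing.isNmodMorphism.Build _ _ _ gclass_mark_is_nmod_morphism.
pose mm := GRing.isMonoidMorphism.Build _ _ _ gclass_mark_is_monoid_morphism.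
pose f : {rmorphism gclass H -> int} := HB.pack gclass_mark nm mm.
by rewrite /mark (groth_extE f) [LHS]gclass_mark_of.
Qed.

End Mark.

Section Restriction.
Variables (gT : finGroupType) (H K : {group gT}) (sKH : K \subset H).

Definition gclass_res (u : gclass H) : gclass K :=
  gclass_of (gclass_act u \ sKH)%act.

Definition res : burnside H -> burnside K := groth_ext (@to_groth _ \o gclass_res).

Lemma gclass_res_of (T : finType) (to : action H T) :
  gclass_res (gclass_of to) = gclass_of (to \ sKH)%act.
Proof.
have [f bf fH] := gclass_act_iso to; apply/gclass_ofP; exists f => // a Ka x.
exact/fH/(subsetP sKH).
Qed.

Fact gclass_res_is_nmod_morphism : nmod_morphism gclass_res.
Proof.
split=> [|u v].
  by rewrite gclass_res_of; apply/gclass_ofP; exists id => //; exists id.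
elim/gclass_ind: u => T1 to1; elim/gclass_ind: v => T2 to2.
rewrite [in LHS]/GRing.add /= gclass_ofD !gclass_res_of [RHS]gclass_ofD.
by apply/gclass_ofP; exists id => //; exists id.
Qed.

Fact gclass_res_is_monoid_morphism : monoid_morphism gclass_res.
Proof.
split=> [|u v].
  by rewrite gclass_res_of; apply/gclass_ofP; exists id => //; exists id.
elim/gclass_ind: u => T1 to1; elim/gclass_ind: v => T2 to2.
rewrite [in LHS]/GRing.mul /= gclass_ofM !gclass_res_of [RHS]gclass_ofM.
by apply/gclass_ofP; exists id => //; exists id.
Qed.

HB.instance Definition _ := GRing.isNmodMorphism.Build (gclass H) (gclass K)
  gclass_res gclass_res_is_nmod_morphism.
HB.instance Definition _ := GRing.isMonoidMorphism.Build (gclass H) (gclass K)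
  gclass_res gclass_res_is_monoid_morphism.
HB.instance Definition _ := GRing.RMorphism.on res.

Lemma res_class (T : finType) (to : action H T) :
  res (burnside_class to) = burnside_class (to \ sKH)%act.
Proof. by rewrite /res groth_extE /= gclass_res_of. Qed.

End Restriction.

Section Coinduction.
Variables (gT : finGroupType) (H K : {group gT}).

Section Action.
Variables (T : finType) (to : action K T).

(* The K-equivariant maps from H to T: for right actions these are the
   functions f such that f (h * k) = f(h) . k for h \in H and k \in K, with
   H acting by (f . g)(h) = f (g * h). *)
Definition coind_pred : pred {ffun subg_of H -> T} := fun f =>
  [forall h, forall k in K, f (h * subg H k)%g == to (f h) k].
Definition coind := {f : {ffun subg_of H -> T} | coind_pred f}.
HB.instance Definition _ := Finite.on coind.

Fact coind_to_subproof (f : coind) (g : gT) :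
  coind_pred [ffun h => val f (subg H g * h)%g].
Proof.
apply/forallP => h; apply/forall_inP => k Kk; rewrite !ffunE mulgA.
exact: (forall_inP (forallP (valP f) _)).
Qed.

Definition coind_to (f : coind) (g : gT) : coind :=
  exist (fun f => coind_pred f) _ (coind_to_subproof f g).

Fact coind_is_action : is_action H coind_to.
Proof.
split=> [g f1 f2 e | f g1 g2 Hg1 Hg2].
  apply/val_inj/ffunP => h; have /(congr1 val)/ffunP/(_ ((subg H g)^-1 * h)%g) := e.
  by rewrite !ffunE mulKVg.
by apply/val_inj/ffunP => h; rewrite !ffunE subgM // mulgA.
Qed.
Definition coind_act := Action coind_is_action.

End Action.

Definition gclass_coind (u : gclass K) : gclass H :=
  gclass_of (coind_act (gclass_act u)).

Lemma gclass_coind_of (T : finType) (to : action K T) :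
  gclass_coind (gclass_of to) = gclass_of (coind_act to).
Proof.
have [f [f' fK f'K] fH] := gclass_act_iso to; apply/gclass_ofP.
have fP (u : coind (gclass_act (gclass_of to))) : coind_pred to [ffun h => f (val u h)].
  apply/forallP => h; apply/forall_inP => k Kk; rewrite !ffunE.
  by rewrite (eqP (forall_inP (forallP (valP u) h) k Kk)) fH.
have f'P (u : coind to) :
    coind_pred (gclass_act (gclass_of to)) [ffun h => f' (val u h)].
  apply/forallP => h; apply/forall_inP => k Kk; rewrite !ffunE.
  rewrite (eqP (forall_inP (forallP (valP u) h) k Kk)).
  by apply/eqP/(can_inj fK); rewrite fH ?f'K.
exists (fun u => exist (fun f => coind_pred to f) _ (fP u)).
  by exists (fun u => exist (fun f => coind_pred _ f) _ (f'P u)) => u; apply/val_inj/ffunP => h;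
    rewrite !ffunE /= ?ffunE ?fK ?f'K.
by move=> a Ha u; apply/val_inj/ffunP => h; rewrite !ffunE.
Qed.

(* Co-induction is a polynomial map of degree at most #|H : K|: the marks of
   coind_act to are products of at most #|H : K| marks of to. *)
Definition norm : burnside K -> burnside H :=
  groth_poly_ext #|H : K| (@to_groth _ \o gclass_coind).

End Coinduction.

Arguments norm {gT} H K x.

Section PPerfect.
Local Open Scope group_scope.
Variables (gT : finGroupType) (P : nat_pred).
Implicit Types Q N L : {group gT}.

Definition solvable_pquotient Q N :=
  [&& N <| Q, solvable (Q / N) & P.-group (Q / N)].

(* O^P(Q); it differs from 'O^P(Q), which ignores solvability. *)
Definition Osol Q : {set gT} :=
  \bigcap_(N : {group gT} | solvable_pquotient Q N) N.
Canonical Osol_group Q := Eval hnf in [group of Osol Q].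

Lemma solvable_pquotientI Q N1 N2 :
    solvable_pquotient Q N1 -> solvable_pquotient Q N2 ->
  solvable_pquotient Q (N1 :&: N2)%G.
Proof.
move=> /and3P[nN1 sN1 pN1] /and3P[nN2 sN2 pN2].
have nI : N1 :&: N2 <| Q by apply: normalI.
have s1Q := normal_sub nN1.
have nN12 : N1 \subset 'N(N2) := subset_trans s1Q (normal_norm nN2).
have iso : N1 / (N1 :&: N2) \isog N1 / N2 by rewrite setIC second_isog.
have sN12 : N1 / N2 \subset Q / N2 by apply: quotientS.
apply/and3P; split=> //.
  rewrite (series_sol (quotient_normal (N1 :&: N2) nN1)).
  rewrite (isog_sol iso) (solvableS sN12 sN2) /=.
  by rewrite (isog_sol (third_isog (subsetIl _ _) nI nN1)).
rewrite /pgroup -(LagrangeI (Q / _) (N1 / (N1 :&: N2))) pnatM.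
rewrite (setIidPr (quotientS _ s1Q)) (card_isog iso).
rewrite (pnat_dvd (cardSg sN12) pN2) /=.
by rewrite -card_quotient ?quotient_norms ?normal_norm //
  (card_isog (third_isog (subsetIl _ _) nI nN1)).
Qed.

Lemma Osol_pquotient Q : solvable_pquotient Q (Osol_group Q).
Proof.
pose ok (A : {set gT}) := exists2 N : {group gT}, A = N & solvable_pquotient Q N.
suff okI (s : seq {group gT}) :
    ok (Q :&: \bigcap_(N <- s | solvable_pquotient Q N) N).
  have [N eN hN] := okI (index_enum _); suff <- : N = Osol_group Q by [].
  apply/val_inj; rewrite /= -eN; apply/setIidPr.
  by apply: bigcap_inf; rewrite /solvable_pquotient normal_refl trivg_quotient
    solvable1 pgroup1.
elim: s => [|N s [M eM hM]].
  rewrite big_nil setIT; exists Q => //.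
  by rewrite /solvable_pquotient normal_refl trivg_quotient solvable1 pgroup1.
rewrite big_cons; case: ifP => hN; last by exists M.
by exists (M :&: N)%G; [rewrite /= -eM setIAC -setIA | apply: solvable_pquotientI].
Qed.

Lemma Osol_min Q N : solvable_pquotient Q N -> Osol Q \subset N.
Proof. by move=> hN; apply: bigcap_inf. Qed.

Definition pperfect L := Osol L == L :> {set gT}.

End PPerfect.

Definition primitive_idempotent (R : pzRingType) (e : R) :=
  [/\ e * e = e, e != 0 &
      forall f g, f * f = f -> g * g = g -> f * g = 0 -> g * f = 0 ->
        e = f + g -> f = 0 \/ g = 0].

Definition corresponding_idempotent (gT : finGroupType) (P : nat_pred)
    (G L : {group gT}) (e : plocal (burnside G) P) :=
  primitive_idempotent e /\
  forall Q : {group gT}, Q \subset G ->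
    plocal_map P (mark Q) e
    = if Osol P Q \in (L : {set gT}) :^: G then 1 else 0 :> plocal int P.

Definition descends (R R' : comPzRingType) (a : R) (b : R') (f : R -> R') :=
  exists f' : away a -> away b,
    monoid_morphism f' /\ forall x, f' (to_away a x) = to_away b (f x).

Arguments corresponding_idempotent {gT} P G L e.

(* Main.v *)
Require Import Defs.
From HB Require Import structures.
From mathcomp Require Import all_boot all_order all_algebra all_fingroup.
From mathcomp Require Import all_solvable generic_quotient boolp ring.

Set Implicit Arguments.
Unset Strict Implicit.
Unset Printing Implicit Defensive.

Import GroupScope GRing.Theory Num.Theory.
Local Open Scope ring_scope.

(** Write [a] and [b] for the images of the idempotent [e] in the localized
Burnside rings of [K] and [H]. Both are idempotent, and localizing at an
idempotent turns it into [1]; hence the norm [N] descends if and only if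
[N a] becomes [1] after inverting [b], that is, if and only if [b * N a = b]
([descends_idempotent]).

This last equation is tested on marks, which are jointly injective
([mark_inj], [plocal_mark_inj]). On a finite [K]-set [X], a map from [H] to [X]
commuting with [K] and fixed by [Q] amounts to the choice, for one [h] in each
double coset [Q h K], of a point of [X] fixed by [K :&: Q :^ h]. So the mark
of [N x] at [Q] is the product of the marks of [x] at the groups
[K :&: Q :^ h] ([mark_norm], [plocal_mark_norm]). The extension to virtual sets
comes from the vanishing of high-order differences of polynomials of bounded
degree ([alternating_binomial_sum]). The same formula shows that [N] is
multiplicative and sends an integer prime to [P] to an element whose marks are
integers prime to [P]; such an element is a unit after localization
([invertible_of_marks]), which is why [N] extends to the localized rings.

The mark of [e] at [Q] is [1] when [Osol P Q] is conjugate to [L] and [0]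
otherwise. Thus [b * N a = b] means: whenever [Osol P Q] is conjugate to [L],
so is [Osol P (K :&: Q :^ h)] for every [h]. Taking [Q] conjugate to [L] and
[h = 1] shows that [Q] must lie in [K]. Conversely, if [K] contains every
conjugate of [L] lying in [H], then
[Osol P (Q :^ h) \subset K :&: Q :^ h \subset Q :^ h], and [Osol P] takes the
same value on all groups between [Osol P Q] and [Q]
([Osol_isotropy_iff]). *)

(** * Units and localization *)

Section Invertible.
Variable R : comPzRingType.
Implicit Types x y : R.

Lemma invertibleM x y : invertible x -> invertible y -> invertible (x * y).
Proof.
by move=> [x' ex] [y' ey]; exists (x' * y'); rewrite mulrACA ex ey mulr1.
Qed.

Lemma invertible_rreg x y z : invertible x -> y * x = z * x -> y = z.
Proof. by move=> [x' ex] e; rewrite -[y]mulr1 -[z]mulr1 -ex !mulrA e. Qed.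

Lemma pinvM x y :
  invertible x -> invertible y -> pinv (x * y) = pinv x * pinv y.
Proof.
by move=> ix iy; apply: pinv_unique; rewrite mulrACA !mulr_pinv ?mulr1.
Qed.

Lemma idem_expr x n : x * x = x -> x * x ^+ n = x.
Proof. by move=> xx; elim: n => [|n IH]; rewrite ?mulr1 // exprS mulrA xx. Qed.

End Invertible.

Lemma monoid_morphism_invertible (R R' : comPzRingType) (f : R -> R') x :
  monoid_morphism f -> invertible x -> invertible (f x).
Proof. by move=> [f1 fM] [y e]; exists (f y); rewrite -fM e. Qed.

Lemma loc_ext_monoid_morphism (R R' : comPzRingType) (S : mulrClosed R)
    (f : R -> R') :
    monoid_morphism f -> (forall s, s \in S -> invertible (f s)) ->
  monoid_morphism (loc_ext S f).
Proof.
move=> fm fS; have [f1 fM] := fm; split.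
  by rewrite -(rmorph1 (to_loc S)) loc_extE.
elim/quotW=> x; elim/quotW=> y.
have -> : (\pi_(loc S)%qT x * \pi_(loc S)%qT y)%R
        = \pi_(loc S)%qT (x.1 * y.1, denomM x.2 y.2) by exact: pi_loc_mul.
rewrite !(loc_ext_pi _ fm fS) [x in f x]/= fM [x in f x]/= fM pinvM.
- by rewrite mulrACA.
- exact: fS (svalP x.2).
- exact: fS (svalP y.2).
Qed.

Section Plocal.
Variable P : nat_pred.

Lemma plocal_fracP (R : comPzRingType) (x : plocal R P) :
  exists n a, P^'.-nat n /\ x * to_plocal P n%:R = to_plocal P a.
Proof.
elim/quotW: x => -[a s]; have /asboolP[n Pn sE] := svalP s.
exists n, a; split=> //; rewrite -sE [LHS]pi_loc_mul; apply/locP.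
by exists 1; rewrite ?rpred1 //=; ring.
Qed.

Lemma to_plocal_nat_invertible (R : comPzRingType) n :
  P^'.-nat n -> invertible (to_plocal P (n%:R : R)).
Proof.
move=> Pn; have Sn : (n%:R : R) \in pnat_elts P by apply/asboolP; exists n.
pose s : denom (@pnat_elts R P) := exist _ n%:R Sn.
exists (\pi_(loc (@pnat_elts R P))%qT (1, s)).
rewrite [LHS]pi_loc_mul; apply/locP.
by exists 1; rewrite ?rpred1 //=; ring.
Qed.

Lemma to_plocal_int_inj : injective (@to_plocal int P).
Proof.
move=> x y /locP[_ /asboolP[n Pn ->]] /=; rewrite !mulr1 => /mulfI; apply.
by rewrite pnatr_eq0 -lt0n; case/andP: Pn.
Qed.

(** The maps to which [plocal_map P] applies meaningfully: for a ring
morphism the second condition is automatic, for the norm it is not. *)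
Definition plocalizable (R R' : comPzRingType) (f : R -> R') :=
  monoid_morphism f /\
  forall n, P^'.-nat n -> invertible (to_plocal P (f n%:R)).

Section Map.
Variables (R R' : comPzRingType) (f : R -> R') (fP : plocalizable f).

Let gm : monoid_morphism (to_plocal P \o f).
Proof.
have [[f1 fM] _] := fP.
by split=> [|x y] /=; rewrite ?f1 ?fM ?rmorph1 ?rmorphM.
Qed.
Let gS s : s \in pnat_elts P -> invertible ((to_plocal P \o f) s).
Proof. by have [_ fn] := fP; case/asboolP=> n Pn ->; apply: fn. Qed.

Lemma plocal_map_monoid_morphism : monoid_morphism (plocal_map P f).
Proof. exact: loc_ext_monoid_morphism. Qed.

Lemma plocal_map_to_plocal a :
  plocal_map P f (to_plocal P a) = to_plocal P (f a).
Proof. exact: (loc_extE a gm gS). Qed.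

End Map.

Lemma rmorphism_plocalizable (R R' : comPzRingType) (f : {rmorphism R -> R'}) :
  plocalizable f.
Proof.
split=> [|n Pn]; first by split; [apply: rmorph1 | apply: rmorphM].
by rewrite rmorph_nat; apply: to_plocal_nat_invertible.
Qed.

(** Integers prime to [P] are units, so a multiplicative map is determined on
fractions by its values on numerators; no additivity is involved, which makes
the principle available for norms. *)
Lemma plocal_ext (R R' : comPzRingType) (f g : plocal R P -> R') :
    monoid_morphism f -> monoid_morphism g ->
  (forall a, f (to_plocal P a) = g (to_plocal P a)) -> f =1 g.
Proof.
move=> fm gm fg x; have [n [a [Pn xE]]] := plocal_fracP x.
have fn : invertible (f (to_plocal P n%:R)).
  by apply: monoid_morphism_invertible fm _; apply: to_plocal_nat_invertible.
apply: (invertible_rreg fn); rewrite [in RHS]fg -fm.2 -gm.2 xE; exact: fg.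
Qed.

End Plocal.

(** An idempotent becomes [1] once inverted. So descent forces [f a] to become
[1] after inverting [b], which means [b * f a = b]; conversely this equation
makes [f] send every power of [a] to [1] after inverting [b]. *)
Lemma descends_idempotent (R R' : comPzRingType) (a : R) (b : R')
    (f : R -> R') :
    monoid_morphism f -> a * a = a -> b * b = b ->
  descends a b f <-> b * f a = b.
Proof.
move=> fm aa bb; split=> [[f' [[f'1 _] f'E]] | bfa].
  have a1 : to_away a a = 1.
    rewrite -(rmorph1 (to_away a)); apply/locP.
    exists a => /=; last by rewrite !mulr1.
    by apply/asboolP; exists 1%N; rewrite expr1.
  have /esym := f'E a; rewrite a1 f'1 -(rmorph1 (to_away b)).
  case/locP=> _ /asboolP[n ->] /= /(congr1 ( *%R b)).
  by rewrite !mulr1 mulrA idem_expr.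
have bfX n : b * f (a ^+ n) = b.
  elim: n => [|n IH]; first by rewrite fm.1 mulr1.
  by rewrite exprS fm.2 mulrA bfa.
have gm : monoid_morphism (to_away b \o f).
  by split=> [|x y] /=; rewrite ?fm.1 ?fm.2 ?rmorph1 ?rmorphM.
have gS s : s \in powers a -> invertible ((to_away b \o f) s).
  case/asboolP=> n ->; exists 1; rewrite mulr1 /= -(rmorph1 (to_away b)).
  apply/locP; exists b => /=; last by rewrite !mulr1.
  by apply/asboolP; exists 1%N; rewrite expr1.
exists (loc_ext (powers a) (to_away b \o f)); split.
  exact: loc_ext_monoid_morphism.
by move=> x; apply: (loc_extE x gm gS).
Qed.

(** * Differences of polynomial functions *)

(** The sum is, up to sign, the [n]-th difference at [x] of a product of fewer
than [n] affine functions, hence zero. In the induction, the identity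
[k * 'C(n.+1, k) = n.+1 * 'C(n, k.-1)] splits off one affine factor: its value
at [x] multiplies the [n.+1]-st difference of the remaining product, and its
slope multiplies the [n]-th difference at [x + 1]. *)
Lemma alternating_binomial_sum (R : comPzRingType) (I : Type) (r : seq I)
    (a b : I -> R) n x :
    (size r < n)%N ->
  \sum_(k < n.+1)
    (-1) ^+ k * \prod_(i <- r) (a i + b i * (x + k%:R)) *+ 'C(n, k) = 0.
Proof.
elim: r n x => [|i r IH] [|n] x //= lt_rn.
  under eq_bigr do rewrite big_nil mulr1.
  have := exprDn (1 : R) (-1) n.+1; rewrite subrr expr0n /= => e0.
  apply: etrans (esym e0).
  by apply: eq_bigr => k _; rewrite expr1n mul1r.
pose p y := \prod_(j <- r) (a j + b j * y).
have e1 : \sum_(k < n.+2) (-1) ^+ k * p (x + k%:R) *+ 'C(n.+1, k) = 0.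
  exact: IH (ltnW lt_rn).
have e2 : \sum_(k < n.+1) (-1) ^+ k * p (x + 1 + k%:R) *+ 'C(n, k) = 0.
  exact: IH lt_rn.
under eq_bigr => k _ do rewrite big_cons -/(p (x + k%:R)).
move: p e1 e2 => p e1 e2.
transitivity (\sum_(k < n.+2)
   ((a i + b i * x) * ((-1) ^+ k * p (x + k%:R) *+ 'C(n.+1, k))
   + b i * ((-1) ^+ k * p (x + k%:R) * (k%:R * 'C(n.+1, k)%:R)))).
  apply: eq_bigr => k _; rewrite -mulr_natr -[((-1) ^+ k * p _) *+ _]mulr_natr.
  by move: (k%:R) ('C(n.+1, k)%:R) (_ ^+ _) (p _) => ? ? ? ?; ring.
rewrite big_split -!mulr_sumr /= e1 mulr0 add0r.
suff -> : \sum_(k < n.+2) (-1) ^+ k * p (x + k%:R) * (k%:R * 'C(n.+1, k)%:R)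
        = - n.+1%:R * \sum_(k < n.+1) (-1) ^+ k * p (x + 1 + k%:R) *+ 'C(n, k).
  by rewrite e2 !mulr0.
rewrite big_ord_recl mul0r mulr0 add0r mulr_sumr.
apply: eq_bigr => k _.
rewrite lift0.
have -> : k.+1%:R * 'C(n.+1, k.+1)%:R = n.+1%:R * 'C(n, k)%:R :> R.
  by rewrite -!natrM mul_bin_diag.
have -> : x + 1 + k%:R = x + k.+1%:R by rewrite -natr1 -addrA [1 + _]addrC.
rewrite -[(_ * _) *+ _]mulr_natr exprS.
by move: (n.+1%:R) ('C(n, k)%:R) (_ ^+ _) (p _) => ? ? ? ?; ring.
Qed.

(** * Solvable P-residuals of subgroups and conjugates *)

Section Osol.
Local Open Scope group_scope.
Variables (gT : finGroupType) (P : nat_pred).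
Implicit Types Q M N L : {group gT}.

(** By the second isomorphism theorem the quotient of [M] by its intersection
with [Osol P Q] embeds into the solvable [P]-group [Q / Osol P Q]. *)
Lemma OsolS M Q : M \subset Q -> Osol P M \subset Osol P Q.
Proof.
move=> sMQ; have /and3P[nN sN pN] := Osol_pquotient P Q.
have nMN : M \subset 'N(Osol P Q) := subset_trans sMQ (normal_norm nN).
have iso := second_isog nMN; have sMN := quotientS (Osol P Q) sMQ.
apply: subset_trans (_ : Osol P Q :&: M \subset _); last exact: subsetIl.
apply: (@Osol_min _ _ _ (Osol_group P Q :&: M)%G); apply/and3P; split.
- by rewrite /normal subsetIr normsI ?normG.
- by rewrite (isog_sol iso) (solvableS sMN).
- by rewrite /pgroup (card_isog iso) (pnat_dvd (cardSg sMN) pN).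
Qed.

Lemma Osol_sub Q : Osol P Q \subset Q.
Proof. by have /and3P[/normal_sub] := Osol_pquotient P Q. Qed.

Lemma solvable_pquotientJ Q N x :
  solvable_pquotient P Q N -> solvable_pquotient P (Q :^ x)%G (N :^ x)%G.
Proof.
case/and3P=> nNQ sN pN; have sNQ := normal_sub nNQ.
pose f := [morphism of conjgm Q x].
have iso : Q / N \isog f @* Q / f @* N.
  apply/isogP; exists [morphism of quotm f nNQ]; last exact: morphim_quotm.
  exact/injm_quotm/injm_conj.
rewrite !morphim_conj setIid (setIidPr sNQ) in iso.
apply/and3P; split; first by rewrite normalJ.
  by rewrite /= -(isog_sol iso).
by rewrite /pgroup /= -(card_isog iso).
Qed.

Lemma OsolJ Q x : Osol P (Q :^ x)%G = Osol P Q :^ x.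
Proof.
suff sub M y : Osol P (M :^ y)%G \subset Osol P M :^ y.
  apply/eqP; rewrite eqEsubset sub sub_conjg.
  have := sub (Q :^ x)%G x^-1.
  by have -> : ((Q :^ x) :^ x^-1 = Q)%G by apply/val_inj; rewrite /= conjsgK.
apply: (@Osol_min _ _ _ (Osol_group P M :^ y)%G).
exact/solvable_pquotientJ/Osol_pquotient.
Qed.

(** By monotonicity [Osol P M] lies between [Osol P (Osol P Q)] and
[Osol P Q]. *)
Lemma Osol_between Q M :
    Osol P (Osol_group P Q) = Osol P Q -> Osol P Q \subset M -> M \subset Q ->
  Osol P M = Osol P Q.
Proof.
move=> idem sOM sMQ; apply/eqP; rewrite eqEsubset OsolS //= -{1}idem.
exact: OsolS.
Qed.

End Osol.

(** * Finite sets with an action are determined by their marks *)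

Section MarkInjective.
Local Open Scope group_scope.
Variables (gT : finGroupType) (H : {group gT}).

Lemma act_eq (T : finType) (to : action H T) x a b : a \in H -> b \in H ->
  (to x a == to x b) = (a \in 'C[x | to] :* b).
Proof.
move=> Ha Hb; have := amove_act to x (subxx H) Hb.
by rewrite (setIidPr (subsetIl _ _)) => <-; rewrite inE Ha.
Qed.

Lemma actsD (T : finType) (to : action H T) (A B : {set T}) :
  [acts H, on A | to] -> [acts H, on B | to] -> [acts H, on A :\: B | to].
Proof.
move=> /acts_act actA /acts_act actB; apply/subsetP=> a Ha.
by rewrite 2!inE Ha; apply/subsetP=> z; rewrite !inE actA ?actB.
Qed.

Lemma card_afixD (T : finType) (to : action H T) (A B : {set T})
    (Q : {set gT}) :
    B \subset A ->
  #|'Fix_(A :\: B | to)(Q)| = (#|'Fix_(A | to)(Q)| - #|'Fix_(B | to)(Q)|)%N.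
Proof.
by move=> sBA; rewrite setIDAC cardsD setIAC (setIidPr sBA).
Qed.

Lemma afix_gt0P (T : finType) (to : action H T) (S : {set T}) (Q : {set gT}) :
    Q \subset H ->
  reflect (exists2 x, x \in S & Q \subset 'C[x | to])
          (0 < #|'Fix_(S | to)(Q)|)%N.
Proof.
move=> sQH; apply: (iffP card_gt0P) => [[x /setIP[Sx Qx]] | [x Sx Qx]].
  by exists x; rewrite ?sub_astab1_in.
by exists x; rewrite inE Sx -sub_astab1_in.
Qed.

Variables (T1 T2 : finType) (to1 : action H T1) (to2 : action H T2).

(** Isomorphisms between invariant subsets are total functions, so that orbits
can be removed and glued back without changing the ambient types. *)
Definition iso_on (A : {set T1}) (B : {set T2}) (f : T1 -> T2) :=
  [/\ {in A &, injective f}, f @: A = B &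
      {in A & H, forall z a, f (to1 z a) = to2 (f z) a}].

Lemma iso_on_orbit x y : 'C[x | to1] = 'C[y | to2] ->
  exists f, iso_on (orbit to1 H x) (orbit to2 H y) f.
Proof.
move=> eqC.
(* The orbit of [x] is identified with that of [y] by [to1 x a |-> to2 y a];
   outside the orbit the value is irrelevant. *)
pose f z := to2 y (odflt 1 [pick a in H | to1 x a == z]).
have fE a : a \in H -> f (to1 x a) = to2 y a.
  move=> Ha; rewrite /f.
  case: pickP => [b /andP[Hb] | /(_ a)]; last by rewrite Ha eqxx.
  by rewrite act_eq // eqC -act_eq // => /eqP.
exists f; split.
- move=> _ _ /imsetP[a Ha ->] /imsetP[b Hb ->]; rewrite !fE // => /eqP.
  by rewrite act_eq // -eqC -act_eq // => /eqP.
- by rewrite /orbit -imset_comp; apply: eq_in_imset.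
- by move=> _ b /imsetP[a Ha ->] Hb; rewrite -actMin // !fE ?groupM // actMin.
Qed.

Lemma iso_on_card_afix A B f (Q : {set gT}) :
    Q \subset H -> [acts H, on A | to1] -> iso_on A B f ->
  #|'Fix_(A | to1)(Q)| = #|'Fix_(B | to2)(Q)|.
Proof.
move=> sQH actA [fI fAB fH]; rewrite -(card_in_imset (f := f)); last first.
  by move=> u v /setIP[Au _] /setIP[Av _]; apply: fI.
apply/eq_card=> z; apply/imsetP/setIP => [[u /setIP[Au /afixP uQ] ->] | []].
  split; first by rewrite -fAB imset_f.
  by apply/afixP=> a Qa; rewrite -fH ?uQ // (subsetP sQH).
rewrite -fAB => /imsetP[u Au ->] /afixP fuQ; exists u => //.
rewrite inE Au; apply/afixP=> a Qa; have Ha := subsetP sQH a Qa.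
by apply: fI; rewrite ?fH ?fuQ // (acts_act actA).
Qed.

Lemma iso_onU (A1 A2 : {set T1}) (B1 B2 : {set T2}) f1 f2 :
    [disjoint A1 & A2] -> [disjoint B1 & B2] ->
    [acts H, on A1 | to1] -> [acts H, on A2 | to1] ->
    iso_on A1 B1 f1 -> iso_on A2 B2 f2 ->
  exists f, iso_on (A1 :|: A2) (B1 :|: B2) f.
Proof.
move=> dA dB actA1 actA2 [I1 E1 H1] [I2 E2 H2].
pose f z := if z \in A1 then f1 z else f2 z.
have f1E : {in A1, f =1 f1} by move=> z Az; rewrite /f Az.
have f2E : {in A2, f =1 f2} by move=> z Az; rewrite /f (disjointFl dA).
have neq u v : u \in A1 -> v \in A2 -> f1 u <> f2 v.
  move=> Au Av e; have := disjointFr dB (_ : f1 u \in B1).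
  by rewrite -E1 imset_f // e -E2 imset_f // => /(_ isT).
exists f; split.
- move=> u v /setUP[] Au /setUP[] Av.
  all: rewrite ?(f1E _ Au) ?(f2E _ Au) ?(f1E _ Av) ?(f2E _ Av).
  + exact: I1.
  + by move/neq; case.
  + by move/esym/neq; case.
  + exact: I2.
- by rewrite imsetU (eq_in_imset f1E) (eq_in_imset f2E) E1 E2.
- move=> u a /setUP[] Au Ha; last by rewrite !f2E ?H2 // (acts_act actA2).
  by rewrite !f1E ?H1 // (acts_act actA1).
Qed.

(** Burnside's theorem, by removing one orbit at a time. A point [x] of [A] with
stabilizer of maximal order matches a point [y] of [B] with the same
stabilizer: equality of marks gives [y] fixed by the stabilizer of [x], then a
point of [A] fixed by the stabilizer of [y], and maximality forces equality.
The orbits of [x] and [y] are then isomorphic, and removing them preserves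
equality of marks. The point of [T2] only provides values outside [A]. *)
Lemma iso_on_of_marks (A : {set T1}) (B : {set T2}) :
    T2 -> [acts H, on A | to1] -> [acts H, on B | to2] ->
    (forall Q : {group gT}, Q \subset H ->
       #|'Fix_(A | to1)(Q)| = #|'Fix_(B | to2)(Q)|) ->
  exists f, iso_on A B f.
Proof.
move=> y0; have [n] := ubnP #|A|.
elim: n A B => // n IH A B leAn actA actB eqAB.
have [A0 | [x0 Ax0]] := set_0Vmem A.
  have := eqAB 1%G (sub1G H); rewrite /= !afix1 !setIT A0 cards0 => /esym/eqP.
  rewrite cards_eq0 => /eqP->; exists (fun=> y0).
  by split=> [u v|| u a]; rewrite ?inE // imset0.
have [x Ax' maxx] := arg_maxnP (fun x => #|'C[x | to1]|) Ax0.
have Ax : x \in A by [].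
have sC1 u : 'C[u | to1] \subset H by apply: subsetIl.
have sC2 v : 'C[v | to2] \subset H by apply: subsetIl.
have [y By sxy] : exists2 y, y \in B & 'C[x | to1] \subset 'C[y | to2].
  apply: (elimT (@afix_gt0P _ to2 B _ (sC1 x))).
  rewrite -(eqAB [group of 'C[x | to1]] (sC1 x)).
  by apply/afix_gt0P => /=; [apply: subsetIl | exists x].
have [z Az syz] : exists2 z, z \in A & 'C[y | to2] \subset 'C[z | to1].
  apply: (elimT (@afix_gt0P _ to1 A _ (sC2 y))).
  rewrite (eqAB [group of 'C[y | to2]] (sC2 y)).
  by apply/afix_gt0P => /=; [apply: subsetIl | exists y].
have eqC : 'C[x | to1] = 'C[y | to2].
  apply/eqP; rewrite eqEcard sxy.
  exact: leq_trans (subset_leq_card syz) (maxx z Az).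
have [f1 f1P] := iso_on_orbit eqC.
have actx := acts_orbit to1 x (subxx H).
have acty := acts_orbit to2 y (subxx H).
have sxA : orbit to1 H x \subset A by rewrite acts_sub_orbit.
have syB : orbit to2 H y \subset B by rewrite acts_sub_orbit.
have [||||f2 f2P] := IH (A :\: orbit to1 H x) (B :\: orbit to2 H y).
- rewrite ltnS in leAn; apply: leq_trans leAn; apply: proper_card.
  rewrite properEneq subsetDl andbT; apply/eqP=> e.
  by have := Ax; rewrite -e in_setD orbit_refl.
- exact: actsD.
- exact: actsD.
- move=> Q sQH; rewrite !card_afixD // eqAB //.
  by rewrite (iso_on_card_afix sQH actx f1P).
have [|||| f fP] := iso_onU _ _ _ _ f1P f2P.
- by rewrite disjoint_sym disjoints_subset setDE subsetIr.
- by rewrite disjoint_sym disjoints_subset setDE subsetIr.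
- exact: actx.
- exact: actsD.
exists f; move: fP; rewrite -{1}(setIidPr sxA) -{1}(setIidPr syB).
by rewrite !setID.
Qed.

Lemma act_iso_of_marks :
    (forall Q : {group gT}, Q \subset H -> #|'Fix_to1(Q)| = #|'Fix_to2(Q)|) ->
  act_iso to1 to2.
Proof.
move=> eqF; have eqT : #|T1| = #|T2|.
  by have := eqF 1%G (sub1G H); rewrite /= !afix1 !cardsT.
have actT (T : finType) (to : action H T) : [acts H, on setT | to].
  by apply/subsetP=> a Ha; rewrite 2!inE Ha; apply/subsetP=> z; rewrite !inE.
case: (pickP (mem T2)) => [y0 _ | T20].
  have [Q sQH|f [fI fT fH]] := iso_on_of_marks y0 (actT _ to1) (actT _ to2).
    by rewrite !setTI eqF.
  exists f; last by move=> a Ha x; apply: fH; rewrite ?inE.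
  apply: inj_card_bij; last by rewrite eqT.
  by move=> u v; apply: fI; rewrite inE.
have T10 (x : T1) : False.
  have : (0 < #|T1|)%N by apply/card_gt0P; exists x.
  by rewrite eqT => /card_gt0P[y _]; have := T20 y.
exists (fun x => False_rect T2 (T10 x)) => [|a _ x]; last by case: (T10 x).
have T20' (y : T2) : False by have := T20 y.
exists (fun y => False_rect T1 (T20' y)) => [x|y]; first by case: (T10 x).
by have := T20 y.
Qed.

End MarkInjective.

(** * Marks on the Burnside ring *)

Section Marks.
Variables (gT : finGroupType) (H : {group gT}).

Definition gclass_mark_rmorphism (Q : {set gT}) (sQH : Q \subset H) :
    {rmorphism gclass H -> int} :=
  HB.pack (@gclass_mark _ H Q)
    (GRing.isNmodMorphism.Build _ _ _ (gclass_mark_is_nmod_morphism sQH))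
    (GRing.isMonoidMorphism.Build _ _ _ (gclass_mark_is_monoid_morphism sQH)).

Definition mark_rmorphism (Q : {set gT}) (sQH : Q \subset H) :
  {rmorphism burnside H -> int} := groth_ext (gclass_mark_rmorphism sQH).

Lemma mark_rmorphismE (Q : {set gT}) (sQH : Q \subset H) :
  mark_rmorphism sQH =1 mark Q.
Proof. by []. Qed.

Lemma mark_inj (u v : burnside H) :
  (forall Q : {group gT}, Q \subset H -> mark Q u = mark Q v) -> u = v.
Proof.
elim/quotW: u => x; elim/quotW: v => y eqm.
apply/grothP; exists 0; rewrite !addr0.
have {}eqm (Q : {group gT}) : Q \subset H ->
    gclass_mark Q (x.1 + y.2) = gclass_mark Q (y.1 + x.2).
  move=> sQH; pose f := gclass_mark_rmorphism sQH.
  have E z : mark Q (\pi_(groth _)%qT z) = f z.1 - f z.2.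
    exact: (groth_ext_pi f).
  have /eqP := eqm Q sQH; rewrite !E subr_eq addrAC eq_sym subr_eq => /eqP e.
  exact: etrans (rmorphD f _ _) (etrans (esym e) (esym (rmorphD f _ _))).
move: eqm; move: (x.1 + y.2) (y.1 + x.2).
elim/gclass_ind=> T1 to1; elim/gclass_ind=> T2 to2 eqm.
apply/gclass_ofP/act_iso_of_marks => Q sQH.
by have := eqm Q sQH; rewrite !gclass_mark_of // => -[].
Qed.

End Marks.

(** * Marks of norms *)

Section Coinduction.
Variables (gT : finGroupType) (H K : {group gT}) (sKH : K \subset H).
Variable Q : {group gT}.
Hypothesis sQH : Q \subset H.
Local Open Scope group_scope.
Notation HT := (subg_of H).

Definition dcoset (h : HT) : {set gT} := Q :* val h * K.
Definition dcoset_rep (h : HT) : HT :=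
  odflt h [pick h' : HT | val h' \in dcoset h].
(** The set of double cosets of [Q] and [K] in [H], encoded by their chosen
representatives. *)
Definition dcosets := {h : HT | dcoset_rep h == h}.
HB.instance Definition _ := Finite.on dcosets.

Lemma dcosetP (h h' : HT) :
  reflect (exists q k, [/\ q \in Q, k \in K & val h' = q * val h * k])
          (val h' \in dcoset h).
Proof.
apply: (iffP mulsgP) => [[u k /rcosetP[q Qq ->] Kk e] | [q [k [Qq Kk e]]]].
  by exists q, k.
by exists (q * val h) k; rewrite // mem_rcoset mulgK.
Qed.

Lemma dcoset_refl h : val h \in dcoset h.
Proof. by apply/dcosetP; exists 1, 1; rewrite !group1 mul1g mulg1. Qed.

Lemma dcoset_eq h h' : val h' \in dcoset h -> dcoset h' = dcoset h.
Proof.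
case/dcosetP=> q [k [Qq Kk e]].
by rewrite /dcoset e !rcosetM (rcoset_id Qq) -mulgA lcoset_id.
Qed.

Lemma dcoset_rep_mem h : val (dcoset_rep h) \in dcoset h.
Proof. by rewrite /dcoset_rep; case: pickP => //= _; apply: dcoset_refl. Qed.

Lemma dcoset_rep_eq h h' :
  dcoset h = dcoset h' -> dcoset_rep h = dcoset_rep h'.
Proof.
rewrite /dcoset_rep => <-; case: pickP => //= no.
by have := no h; rewrite dcoset_refl.
Qed.

Lemma dcoset_rep_id h : dcoset_rep (dcoset_rep h) == dcoset_rep h.
Proof. by apply/eqP/dcoset_rep_eq/dcoset_eq/dcoset_rep_mem. Qed.

Definition dcoset_of (h : HT) : dcosets :=
  exist _ (dcoset_rep h) (dcoset_rep_id h).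

(** The left coset [h *: K] determines the double coset of [h]. The bound is
what makes the norm polynomial of degree at most [#|H : K|]. *)
Lemma card_dcosets : (#|{: dcosets}| <= #|H : K|)%N.
Proof.
pose lcoset_of (i : dcosets) := (val (val i) *: K)%g.
rewrite -card_lcosets -(card_imset (f := lcoset_of)).
  apply/subset_leq_card/subsetP=> _ /imsetP[i _ ->].
  by apply/imsetP; exists (val (val i)); rewrite ?lcosetE // subgP.
move=> i j; rewrite /lcoset_of => eqK; apply/val_inj.
rewrite -(eqP (valP i)) -(eqP (valP j)).
by apply: dcoset_rep_eq; rewrite /dcoset -!mulgA eqK.
Qed.

Lemma dcoset_decomp h : exists q k,
  [/\ q \in Q, k \in K & val h = q * val (dcoset_rep h) * k].
Proof.
by apply/dcosetP; rewrite (dcoset_eq (dcoset_rep_mem h)) dcoset_refl.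
Qed.

Lemma dcoset_of_eq h h' : val h' \in dcoset h -> dcoset_of h' = dcoset_of h.
Proof. by move=> hh'; apply/val_inj/dcoset_rep_eq/dcoset_eq. Qed.

Lemma dcoset_of_val i : dcoset_of (val i) = i.
Proof. exact/val_inj/eqP/(valP i). Qed.

(** The stabilizer in [K] of the right coset of [Q] by the representative of
[i]. *)
Definition isotropy (i : dcosets) : {group gT} := (K :&: Q :^ val (val i))%G.

(** An equivariant map fixed by [Q] satisfies [f (q * h * k) = (f h) k], so it
is determined by its values at the representatives [h]; such a value can be
any point fixed by the [k] in [K] with [h * k] in [Q :* h], that is, by
[K :&: Q :^ h]. *)
Lemma card_fix_coind (T : finType) (to : action K T) :
  #|'Fix_(coind_act H to)(Q)| = (\prod_(i : dcosets) #|'Fix_to(isotropy i)|)%N.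
Proof.
pose F (i : dcosets) : pred T := mem 'Fix_to(isotropy i).
transitivity #|(family F : simpl_pred {ffun dcosets -> T})|; last first.
  by rewrite card_family /image_mem -big_enum /= foldrE big_map.
pose r (f : coind H to) : {ffun dcosets -> T} := [ffun i => val f (val i)].
have fK (f : coind H to) h k :
    k \in K -> val f (h * subg H k) = to (val f h) k.
  by move=> Kk; apply/eqP; apply: (forall_inP (forallP (valP f) h)).
have fixP (f : coind H to) :
    reflect (forall q h, q \in Q -> val f (subg H q * h) = val f h)
            (f \in 'Fix_(coind_act H to)(Q)).
  apply: (iffP afixP) => [fQ q h Qq | fQ q Qq].
    have := congr1 (fun f : coind H to => val f h) (fQ q Qq).
    by rewrite /= ffunE.
  by apply/val_inj/ffunP=> h; rewrite /= ffunE fQ.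
have subE q h k : q \in Q -> k \in K -> forall h' : HT,
    val h' = q * val h * k -> h' = subg H q * h * subg H k.
  move=> Qq Kk h' e; apply: val_inj.
  by rewrite e /= !subgK //; [apply: (subsetP sKH) | apply: (subsetP sQH)].
rewrite -(card_in_imset (f := r)); last first.
  move=> f1 f2 /fixP f1Q /fixP f2Q e; apply/val_inj/ffunP => h.
  have [q [k [Qq Kk /(subE _ _ _ Qq Kk) ->]]] := dcoset_decomp h.
  rewrite -!mulgA f1Q // f2Q // !fK //; congr (to _ k).
  by have /ffunP/(_ (dcoset_of h)) := e; rewrite !ffunE.
apply/eq_card => g; apply/imsetP/familyP => [[f /fixP fQ ->] i | gF].
  rewrite ffunE; apply/afixP=> k /setIP[Kk /imsetP[q Qq ek]].
  rewrite -fK // -[RHS](fQ q) //; congr (val f _); apply: val_inj.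
  have [Hk Hq] := (subsetP sKH k Kk, subsetP sQH q Qq).
  by rewrite /= !subgK // ek conjgE !mulgA mulgV mul1g.
(* Given a choice [g] of fixed points, [f] sends [q * h * k], with [h] a
   representative, to [g h] acted on by [k]; the decomposition is not unique,
   but two choices of [k] differ by an element fixing [g h]. *)
pose kk (h : HT) := odflt 1
  [pick k in K | [exists q in Q, val h == q * val (dcoset_rep h) * k]].
pose f := [ffun h => to (g (dcoset_of h)) (kk h)].
have fE h q k : q \in Q -> k \in K -> val h = q * val (dcoset_rep h) * k ->
    f h = to (g (dcoset_of h)) k.
  move=> Qq Kk eh; rewrite ffunE /kk.
  case: pickP => [k' /andP[Kk'] | /(_ k)]; last first.
    by rewrite Kk /= => /existsP[]; exists q; rewrite Qq -eh eqxx.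
  case/existsP=> q' /andP[Qq' /eqP eh'].
  have /afixP/(_ (k' * k^-1)) := gF (dcoset_of h).
  rewrite inE groupM ?groupV // => gfix.
  rewrite -{2}gfix; first by rewrite -actMin ?groupM ?groupV // mulgKV.
  apply/imsetP; exists (q'^-1 * q); rewrite ?groupM ?groupV //=.
  have : q * sgval (dcoset_rep h) * k = q' * sgval (dcoset_rep h) * k'.
    by rewrite -eh -eh'.
  move: (sgval (dcoset_rep h)) => c e.
  have -> : k' = (q' * c)^-1 * (q * c * k) by rewrite e mulKg.
  by rewrite conjgE invMg !mulgA mulgK.
have fP : coind_pred to f.
  apply/forallP => h; apply/forall_inP=> k Kk.
  have [q [k1 [Qq Kk1 eh]]] := dcoset_decomp h.
  have hk : val (h * subg H k)%g \in dcoset h.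
    by apply/dcosetP; exists 1, k; rewrite mul1g /= subgK ?(subsetP sKH).
  rewrite (fE _ _ _ Qq Kk1 eh) -actMin //.
  rewrite (fE _ q (k1 * k)) ?groupM ?(dcoset_of_eq hk) //.
  rewrite (dcoset_rep_eq (dcoset_eq hk)) mulgA -eh /= subgK //.
  exact: subsetP sKH _ Kk.
exists (exist (fun f => coind_pred to f) f fP).
  apply/fixP=> q h Qq; rewrite /=.
  have [q1 [k1 [Qq1 Kk1 eh]]] := dcoset_decomp h.
  have hq : val (subg H q * h)%g \in dcoset h.
    by apply/dcosetP; exists q, 1; rewrite mulg1 /= subgK ?(subsetP sQH).
  rewrite (fE _ _ _ Qq1 Kk1 eh).
  rewrite (fE _ (q * q1) k1) ?groupM ?(dcoset_of_eq hq) //.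
  rewrite (dcoset_rep_eq (dcoset_eq hq)) -!mulgA mulgA -mulgA [q1 * _]mulgA -eh.
  by rewrite /= subgK ?(subsetP sQH).
apply/ffunP=> i; rewrite ffunE /= (fE _ 1 1) ?group1 ?dcoset_of_val ?act1 //.
by rewrite mul1g mulg1 (eqP (valP i)).
Qed.

Local Open Scope ring_scope.

Lemma gclass_mark_coind (u : gclass K) :
  gclass_mark Q (gclass_coind H u)
  = \prod_(i : dcosets) gclass_mark (isotropy i) u.
Proof.
rewrite /gclass_coind gclass_mark_of // card_fix_coind.
exact: (big_morph Posz PoszM (erefl 1%:Z)).
Qed.

(** On [a + b *+ j] the formula for sets gives the product over the double
cosets of the affine functions [m i a + m i b * j] of [j]. The alternating sum
defining the norm of [a - b] extrapolates this product from [j = 0, ..., d] to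
[j = -1], where it is the product of the marks of [a - b]. *)
Lemma mark_norm (u : burnside K) :
  mark Q (norm H K u) = \prod_(i : dcosets) mark (isotropy i) u.
Proof.
have sIK i : isotropy i \subset K by apply: subsetIl.
pose m i := gclass_mark_rmorphism (sIK i).
rewrite -(mark_rmorphismE sQH) /norm /groth_poly_ext.
rewrite [RHS](_ : _ = \prod_i (m i (repr u).1 - m i (repr u).2)); last by [].
move: (repr u).1 (repr u).2 => a b.
have size_dc : (size (index_enum dcosets) <= #|H : K|)%N.
  rewrite -(card_uniqP (index_enum_uniq _)).
  exact: leq_trans (max_card _) card_dcosets.
have := @alternating_binomial_sum int _ (index_enum dcosets)
  (fun i => m i a) (fun i => m i b) #|H : K|.+1 (-1).
rewrite ltnS => /(_ size_dc).
rewrite big_ord_recl bin0 expr0 mul1r mulr1n addr0 => /eqP.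
under eq_bigr => i _ do rewrite mulrN1.
rewrite addr_eq0 => /eqP ->.
rewrite [LHS]rmorph_sum -sumrN; apply: eq_bigr => j _.
rewrite lift0 exprS mulN1r mulNr mulNrn opprK.
rewrite [LHS]rmorphMn; congr (_ *+ _).
rewrite [LHS]rmorphM rmorphXn rmorphN1; congr (_ * _).
transitivity (gclass_mark Q (gclass_coind H (a + b *+ j))).
  exact: (groth_extE (gclass_mark_rmorphism sQH)).
rewrite gclass_mark_coind; apply: eq_bigr => i _.
transitivity (m i (a + b *+ j)); first by [].
by rewrite rmorphD rmorphMn -natr1 addrCA subrr addr0 mulr_natr.
Qed.

End Coinduction.

(** * Localized marks *)

Lemma prod_sub_mod (R : comPzRingType) (I : Type) (r : seq I) (p : pred I)
    (m : I -> R) (z : R) :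
  exists y, \prod_(i <- r | p i) (m i - z) = \prod_(i <- r | p i) m i - z * y.
Proof.
elim: r => [|i r [y IH]]; first by exists 0; rewrite !big_nil mulr0 subr0.
rewrite !big_cons; case: (p i); last by exists y.
exists (m i * y + \prod_(j <- r | p j) m j - z * y); rewrite IH.
by move: (\prod_(_ <- _ | _) _) => M; ring.
Qed.

Section LocalMarks.
Variables (gT : finGroupType) (P : nat_pred).
Implicit Types H K Q : {group gT}.

(** All marks of the product of [mark Q z - z] over the subgroups [Q] vanish, so
the product is zero; expanding it, [z] divides the product of the numbers
[mark Q z], an integer prime to [P]. *)
Lemma invertible_of_marks H (z : burnside H) :
    (forall Q, Q \subset H -> exists2 n, P^'.-nat n & mark Q z = n%:R) ->
  invertible (to_plocal P z).
Proof.
move=> zP; pose n Q := `|mark Q z|%N.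
have nP Q : Q \subset H -> P^'.-nat (n Q) /\ mark Q z = (n Q)%:R.
  move=> sQH; have [m Pm] := zP Q sQH; rewrite natz => e.
  by rewrite /n e absz_nat natz.
have [y] := prod_sub_mod (index_enum {group gT}) (fun Q => Q \subset H)
  (fun Q => (n Q)%:R) z.
set N := \prod_(i <- _ | _) _%:R => e.
have {e} Ny : N = z * y.
  apply/eqP; rewrite -subr_eq0 -e; apply/eqP/mark_inj => Q sQH.
  rewrite -!(mark_rmorphismE sQH) rmorph_prod rmorph0 (bigD1 Q) //.
  rewrite rmorphB rmorph_nat [mark_rmorphism _ z](nP Q sQH).2 subrr.
  exact: mul0r.
suff [M PM eN] : exists2 m, P^'.-nat m & N = m%:R.
  have [w ew] := to_plocal_nat_invertible (burnside H) PM.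
  by exists (to_plocal P y * w); rewrite mulrA -rmorphM -Ny eN.
rewrite /N; elim/big_ind: _ => [|_ _ [a Pa ->] [b Pb ->]|Q /nP[PQ _]].
- by exists 1%N.
- by exists (a * b)%N; rewrite ?natrM // pnatM Pa.
- by exists (n Q).
Qed.

(** Both halves follow from the product formula for the marks of a norm: marks
are multiplicative and fix the integers. *)
Lemma norm_plocalizable H K : K \subset H -> plocalizable P (norm H K).
Proof.
move=> sKH.
have sT Q (i : dcosets H K Q) : isotropy i \subset K by apply: subsetIl.
split=> [|m Pm].
  split=> [|u v]; apply: mark_inj => Q sQH; rewrite ?mark_norm //.
    rewrite -(mark_rmorphismE sQH) rmorph1 big1 // => i _.
    by rewrite -(mark_rmorphismE (sT _ i)) rmorph1.
  rewrite -(mark_rmorphismE sQH) rmorphM !mark_rmorphismE !mark_norm //.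
  rewrite -big_split.
  by apply: eq_bigr => i _; rewrite -!(mark_rmorphismE (sT _ i)) rmorphM.
apply: invertible_of_marks => Q sQH; rewrite mark_norm //.
elim/big_ind: _ => [|_ _ [a Pa ->] [b Pb ->]|i _].
- by exists 1%N.
- by exists (a * b)%N; rewrite ?natrM // pnatM Pa.
- by exists m; rewrite // -(mark_rmorphismE (sT _ i)) rmorph_nat.
Qed.

Lemma mark_plocalizable H Q : Q \subset H -> plocalizable P (@mark _ H Q).
Proof. by move=> sQH; apply: rmorphism_plocalizable (mark_rmorphism sQH). Qed.

Lemma plocal_mark_inj H (x y : plocal (burnside H) P) :
    (forall Q, Q \subset H ->
      plocal_map P (mark Q) x = plocal_map P (mark Q) y) ->
  x = y.
Proof.
move=> eqm; have [n [a [Pn xE]]] := plocal_fracP x.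
have [m [b [Pm yE]]] := plocal_fracP y.
have Inm := invertibleM (to_plocal_nat_invertible (burnside H) Pn)
  (to_plocal_nat_invertible (burnside H) Pm).
apply: (invertible_rreg Inm).
have -> : x * (to_plocal P n%:R * to_plocal P m%:R) = to_plocal P (a * m%:R).
  by rewrite mulrA xE rmorphM.
have -> : y * (to_plocal P n%:R * to_plocal P m%:R) = to_plocal P (b * n%:R).
  by rewrite mulrCA yE mulrC rmorphM.
congr (to_plocal P _); apply: mark_inj => Q sQH.
have mP := mark_plocalizable sQH; have [_ mM] := plocal_map_monoid_morphism mP.
apply: (@to_plocal_int_inj P).
rewrite -!(plocal_map_to_plocal mP).
rewrite !rmorphM /= !mM -xE -yE !mM eqm //.
by rewrite mulrAC.
Qed.

Lemma mark_res H K (sKH : K \subset H) Q (u : burnside H) : Q \subset K ->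
  mark Q (res sKH u) = mark Q u.
Proof.
move=> sQK; have sQH := subset_trans sQK sKH.
have E v : mark Q (res sKH (to_groth v)) = mark Q (to_groth v).
  pose g := [the {rmorphism _ -> _} of @to_groth _ \o gclass_res sKH].
  have -> : res sKH (to_groth v) = to_groth (gclass_res sKH v).
    exact: (groth_extE g).
  have -> : mark Q (to_groth (gclass_res sKH v))
          = gclass_mark Q (gclass_res sKH v).
    exact: (groth_extE (gclass_mark_rmorphism sQK)).
  have -> : mark Q (to_groth v) = gclass_mark Q v.
    exact: (groth_extE (gclass_mark_rmorphism sQH)).
  by elim/gclass_ind: v => T to; rewrite gclass_res_of !gclass_mark_of.
have B (K' : {group gT}) (sQK' : Q \subset K') v w :
    mark Q (v - w : burnside K') = mark Q v - mark Q w.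
  exact: (rmorphB (mark_rmorphism sQK')).
rewrite (grothE u); move: (repr u).1 (repr u).2 => a b.
by rewrite rmorphB B // !E B.
Qed.

Lemma plocal_mark_res H K (sKH : K \subset H) Q (x : plocal (burnside H) P) :
    Q \subset K ->
  plocal_map P (mark Q) (plocal_map P (res sKH) x) = plocal_map P (mark Q) x.
Proof.
move=> sQK; have sQH := subset_trans sQK sKH.
have rP := rmorphism_plocalizable P (res sKH).
have [mKP mHP] := (mark_plocalizable sQK, mark_plocalizable sQH).
have [r1 rM] := plocal_map_monoid_morphism rP.
have [mK1 mKM] := plocal_map_monoid_morphism mKP.
move: x; apply: plocal_ext; last 2 first.
- exact: plocal_map_monoid_morphism.
- move=> a; rewrite (plocal_map_to_plocal rP) (plocal_map_to_plocal mKP).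
  by rewrite (plocal_map_to_plocal mHP) mark_res.
by split=> [|x y]; rewrite ?r1 ?mK1 ?rM ?mKM.
Qed.

Lemma plocal_mark_norm H K Q (x : plocal (burnside K) P) :
    K \subset H -> Q \subset H ->
  plocal_map P (mark Q) (plocal_map P (norm H K) x)
  = \prod_(i : dcosets H K Q) plocal_map P (mark (isotropy i)) x.
Proof.
move=> sKH sQH.
have sT (i : dcosets H K Q) : isotropy i \subset K by apply: subsetIl.
have nP := norm_plocalizable sKH; have mP := mark_plocalizable sQH.
have tP i := mark_plocalizable (sT i).
have [n1 nM] := plocal_map_monoid_morphism nP.
have [m1 mM] := plocal_map_monoid_morphism mP.
have tm i := plocal_map_monoid_morphism (tP i).
move: x; apply: plocal_ext => [||a].
- by split=> [|x y]; rewrite ?n1 ?m1 ?nM ?mM.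
- split=> [|x y]; first by rewrite big1 // => i _; rewrite (tm i).1.
  by rewrite -big_split; apply: eq_bigr => i _; rewrite (tm i).2.
rewrite (plocal_map_to_plocal nP) (plocal_map_to_plocal mP) mark_norm //.
rewrite rmorph_prod.
by apply: eq_bigr => i _; rewrite (plocal_map_to_plocal (tP i)).
Qed.

End LocalMarks.

(** * Descent of the norm *)

Section GroupTheory.
Local Open Scope group_scope.
Variables (gT : finGroupType) (P : nat_pred).
Implicit Types G H K L Q M : {group gT}.

Lemma Osol_conj_pperfect G L M : pperfect P L -> (M : {set gT}) \in L :^: G ->
  Osol P M = M.
Proof.
move=> /eqP L_perf /imsetP[g _ eM].
have -> : M = (L :^ g)%G by apply/val_inj.
by rewrite OsolJ L_perf.
Qed.

(** The left side is the condition on marks for the norm to descend. From left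
to right it is applied to [Q := L'] and the double coset of [1]: an order count
shows that the isotropy group is the whole conjugate of [L'], which therefore
lies in [K]. From right to left, [Osol P (Q :^ h)] is a conjugate of [L]
contained in [H], hence in [K], and the isotropy group is squeezed between it
and [Q :^ h]. *)
Lemma Osol_isotropy_iff (G L H K : {group gT}) :
    pperfect P L -> H \subset G ->
  (forall Q, Q \subset H -> Osol P Q \in (L : {set gT}) :^: G ->
     forall i : dcosets H K Q, Osol P (isotropy i) \in (L : {set gT}) :^: G)
  <-> (forall L' : {group gT}, L' \subset H ->
        (L' : {set gT}) \in (L : {set gT}) :^: G -> L' \subset K).
Proof.
move=> L_perf sHG; split=> [tw L' sL'H L'L | starred Q sQH QL i].
  have OL' := Osol_conj_pperfect L_perf L'L.
  have [q [k [L'q Kk e1]]] := @dcoset_decomp _ H K L' 1.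
  have := tw L' sL'H; rewrite OL' => /(_ L'L (dcoset_of K L' (1 : subg_of H))).
  set c := dcoset_rep _ _ _ in e1 => twL.
  (* The chosen representative of the double coset of [1] need not be [1]. *)
  have ec : sgval c = q^-1 * k^-1.
    by apply: (mulgI q); apply: (mulIg k); rewrite -e1 mulKVg mulVg.
  have cards : (#|L' :^ sgval c| <= #|K :&: L' :^ sgval c|)%N.
    pose I := isotropy (dcoset_of K L' (1 : subg_of H)).
    apply: leq_trans (subset_leq_card (Osol_sub P I)).
    have [[g _ ->] [g' _ ->]] := (imsetP L'L, imsetP twL).
    by rewrite !cardJg.
  have : L' :^ sgval c \subset K.
    apply/setIidPr/eqP; rewrite setIC eqEcard subsetIl setIC; exact: cards.
  rewrite ec conjsgM conjGid ?groupV // sub_conjg invgK.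
  by rewrite conjGid.
pose c := val (val i); have Hc : c \in H by apply: subgP.
have Gc := subsetP sHG c Hc.
have QcL : Osol P (Q :^ c)%G \in (L : {set gT}) :^: G.
  case/imsetP: QL => g Gg e.
  by apply/imsetP; exists (g * c); rewrite ?groupM // OsolJ e conjsgM.
have sOH : Osol P (Q :^ c)%G \subset H.
  by rewrite (subset_trans (Osol_sub _ _)) //= conj_subG.
have sOK := starred (Osol_group P (Q :^ c)%G) sOH QcL.
rewrite (@Osol_between _ P (Q :^ c)%G (isotropy i)) //.
- exact: Osol_conj_pperfect L_perf QcL.
- by rewrite subsetI sOK Osol_sub.
- exact: subsetIr.
Qed.

End GroupTheory.

Theorem theorem4p1 (gT : finGroupType) (G : {group gT})
  (P : nat_pred) (P_prime : {subset P <= prime})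
  (L : {group gT}) (sLG : L \subset G) (L_perfect : pperfect P L)
  (e : plocal (burnside G) P) (e_L : corresponding_idempotent P G L e)
  (H K : {group gT}) (sKH : K \subset H) (sHG : H \subset G) :
  descends (plocal_map P (res (subset_trans sKH sHG)) e)
           (plocal_map P (res sHG) e)
           (plocal_map P (norm H K))
  <-> (forall L' : {group gT}, L' \subset H ->
        (L' : {set gT}) \in ((L : {set gT}) :^: G)%g -> L' \subset K).
Proof.
have [[ee _ _] markE] := e_L.
have sKG := subset_trans sKH sHG.
have resM (M : {group gT}) (sMG : M \subset G) :=
  plocal_map_monoid_morphism (rmorphism_plocalizable P (res sMG)).
have res_idem (M : {group gT}) (sMG : M \subset G) :
    plocal_map P (res sMG) e * plocal_map P (res sMG) e
    = plocal_map P (res sMG) e.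
  by rewrite -(resM _ sMG).2 ee.
have normM := plocal_map_monoid_morphism (norm_plocalizable P sKH).
rewrite (descends_idempotent normM (res_idem _ _) (res_idem _ _)).
rewrite -(Osol_isotropy_iff K L_perfect sHG).
have one_neq0 : 1 != 0 :> plocal int P.
  apply/eqP; rewrite -(rmorph1 (@to_plocal int P)).
  rewrite -(rmorph0 (@to_plocal int P)).
  by move/to_plocal_int_inj.
have markb (Q : {group gT}) : Q \subset H ->
  plocal_map P (mark Q) (plocal_map P (res sHG) e)
  = if Osol P Q \in (L : {set gT}) :^: G then 1 else 0 :> plocal int P.
  by move=> sQH; rewrite plocal_mark_res // markE // (subset_trans sQH).
have markNa (Q : {group gT}) : Q \subset H ->
  plocal_map P (mark Q) (plocal_map P (norm H K)
    (plocal_map P (res (subset_trans sKH sHG)) e))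
  = \prod_(i : dcosets H K Q)
      if Osol P (isotropy i) \in (L : {set gT}) :^: G then 1 else 0
      :> plocal int P.
  move=> sQH; rewrite plocal_mark_norm //; apply: eq_bigr => i _.
  have sIK : isotropy i \subset K by apply: subsetIl.
  by rewrite plocal_mark_res // markE // (subset_trans sIK).
split=> [bNa Q sQH QL i | tw].
  have := congr1 (plocal_map P (mark Q)) bNa.
  rewrite (plocal_map_monoid_morphism (mark_plocalizable P sQH)).2 markb //.
  rewrite QL mul1r.
  rewrite markNa // (bigD1 i) //; case: ifP => // _ /esym/eqP.
  by rewrite /= mul0r (negPf one_neq0).
apply: plocal_mark_inj => Q sQH.
rewrite (plocal_map_monoid_morphism (mark_plocalizable P sQH)).2 markb //.
rewrite markNa //.
case: ifP => QL; last by rewrite mul0r.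
by rewrite mul1r big1 // => i _; rewrite tw.
Qed.
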